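(* Let $Q$ be a network with $l$ leaf nodes and generalized girth $g^*$, and let $0<\alpha\le g^*$. Then the value of the continuous patrolling game on $Q$ with attack duration $\alpha$ is $$V=\frac{\alpha}{\mu+l\alpha/2}.$$ An optimal Patroller strategy is the randomized periodic extension of $S_2^\alpha$. An optimal Attacker strategy is the independent attack strategy with $I$ the set of leaf nodes.
   Context: A network $Q$ is a finite connected graph, possibly with multiple arcs and loops and with no node of degree two, and it is not a single line segment. Each arc $a$ is identified with an open interval of positive length $\lambda(a)$. The length measure $\lambda$ on $Q$ is Lebesgue measure on the arcs, $\mu=\lambda(Q)$, and $d$ is the shortest-path metric. A leaf node is a node of degree $1$ and its incident arc is a leaf arc. The game is as follows. The Patroller picks a unit speed patrol $S:[0,\infty)\to Q$, meaning $d(S(t),S(t'))\le|t-t'|$. The Attacker picks $x\in Q$ and a start time $\tau\ge0$. The Patroller wins (payoff $1$) iff $x\in S([\tau,\tau+\alpha])$, and gets payoff $0$ otherwise. $V$ is the value of the game under mixed strategies. It is assumed that $0<\alpha<\bar\mu$, the minimum length of a closed path covering $Q$. A circuit is a closed path consisting of distinct adjacent arcs. The generalized girth $g^*$ is the minimum of the lengths of all circuits of $Q$ and of twice the length of each leaf arc (it is $\infty$ if neither exists). Let $S_2$ be a closed unit speed path of $Q$ that traverses every arc exactly twice and never traverses an arc twice in succession in opposite directions, except for leaf arcs; such paths exist. $S_2^\alpha$ is the closed path that follows $S_2$ but stops for time $\alpha$ each time it reaches a leaf node. For a closed unit speed path $S:[0,L]\to Q$, its randomized periodic extension is the mixed patrol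 $t\mapsto S((t+\Delta)\bmod L)$ with $\Delta$ uniform on $[0,L]$. A set $I\subseteq Q$ is independent if any two of its points are at distance at least $\alpha$. For a finite independent set $I$ with $|I|=l$, let $W$ be the set of points at distance at most $\alpha/2$ from $I$, let $W^c=Q\setminus W$, and let $p=l\alpha/(\lambda(W^c)+l\alpha)$. The independent attack strategy does the following: - with probability $p$, it attacks an equiprobably chosen element of $I$ at a start time uniform in $[0,\alpha]$; - with probability $1-p$, it attacks a point chosen uniformly (according to $\lambda$) in $W^c$ at start time $\alpha/2$. *)

(* Defs.v *)
From HB Require Import structures.
From mathcomp Require Import all_boot all_order all_algebra finmap ring lra.
From mathcomp Require Import all_classical all_reals all_analysis measurable_realfun.

Set Implicit Arguments.
Unset Strict Implicit.
Unset Printing Implicit Defensive.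

Import Order.TTheory GRing.Theory Num.Theory.
Import numFieldNormedType.Exports.

Local Open Scope classical_set_scope.
Local Open Scope ring_scope.

(* The two ends of an arc may coincide (loop), and several arcs may have the
   same ends.  A loop counts twice in the degree of its node.  A graph reduced
   to a single node has no arcs and is not considered as a network; the only
   connected graph with one arc and two nodes is a line segment. *)
Record network (R : realType) := Network {
  node : finType;
  arc : finType;
  src : arc -> node;
  dst : arc -> node;
  len : arc -> R;
  len_gt0 : forall a, 0 < len a;
  has_arc : (0 < #|arc|)%N;
  net_connected : forall u v : node,
    connect (fun x y => [exists a, ((src a == x) && (dst a == y))
                                || ((src a == y) && (dst a == x))]) u v;
  no_degree2 : forall v : node,
    (#|[set a | src a == v]%SET| + #|[set a | dst a == v]%SET|)%N != 2%N;
  not_segment : ~~ ((#|arc| == 1%N) && (#|node| == 2%N)) }.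

Arguments src {R n}.
Arguments dst {R n}.
Arguments len {R n}.
Arguments len_gt0 {R n}.

Section Points.
Variables (R : realType) (Q : network R).
Implicit Types (v : node Q) (a : arc Q) (x y : R).

Definition degree v : nat :=
  (#|[set a | src a == v]%SET| + #|[set a | dst a == v]%SET|)%N.

Definition leaf v : bool := degree v == 1%N.

Definition leaf_arc a : bool := leaf (src a) || leaf (dst a).

Definition inner_point : Type := {p : arc Q * R | 0 < p.2 < len p.1}.

Definition netpoint : Type := (node Q + inner_point)%type.

HB.instance Definition _ := Choice.on netpoint.

Definition npoint v : netpoint := inl v.

(* The point at distance x from the source along the arc a, for x in
   [0, len a]; outside this interval x is clamped. *)
Definition along a x : netpoint :=
  match insub (a, x) : option inner_point with
  | Some p => inr p
  | None => if x <= 0 then npoint (src a) else npoint (dst a)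
  end.

(* The piece (a, (x, y)) runs inside the closed arc a from abscissa x to
   abscissa y; a route is a chain of such pieces. *)
Definition piece : Type := (arc Q * (R * R))%type.

Fixpoint route (p : netpoint) (c : seq piece) (q : netpoint) : Prop :=
  match c with
  | [::] => p = q
  | s :: c' => [/\ 0 <= s.2.1 <= len s.1, 0 <= s.2.2 <= len s.1,
                   p = along s.1 s.2.1 & route (along s.1 s.2.2) c' q]
  end.

Definition route_len (c : seq piece) : R := \sum_(s <- c) `|s.2.1 - s.2.2|.

Definition sp_dist (p q : netpoint) : R :=
  inf [set route_len c | c in [set c | route p c q]].

Lemma along0 a : along a 0 = npoint (src a).
Proof.
by rewrite /along; case: insubP => [[u U]/= /andP[]|_]; rewrite /= ?ltxx ?lexx.
Qed.

Lemma along_le0 a x : x <= 0 -> along a x = npoint (src a).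
Proof.
move=> x0; rewrite /along; case: insubP => [u /= /andP[]|_]; last by rewrite x0.
by rewrite ltNge x0.
Qed.

Lemma along_ge a x : len a <= x -> along a x = npoint (dst a).
Proof.
move=> x0; rewrite /along; case: insubP => [u /= /andP[_]|_].
  by rewrite ltNge x0.
by rewrite leNgt (lt_le_trans (len_gt0 a)).
Qed.

Lemma along_len a : along a (len a) = npoint (dst a).
Proof. exact: along_ge. Qed.

Lemma along_inner (p : inner_point) : along (val p).1 (val p).2 = inr p.
Proof.
rewrite /along -surjective_pairing; case: insubP => [u _ /val_inj->//|].
by rewrite (valP p).
Qed.

Lemma along_clamp a x : exists2 y : R, 0 <= y <= len a &
  along a x = along a y /\ y = Num.min (len a) (Num.max 0 x).
Proof.
have la := ltW (len_gt0 a).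
have [x0|x0] := lerP x 0.
  exists 0; first by rewrite lexx.
  by rewrite along_le0// along0; split=> //; rewrite min_r.
have [xl|xl] := lerP (len a) x.
  by exists (len a); rewrite ?la ?lexx// along_ge// along_len.
by exists x; rewrite ?(ltW x0) ?(ltW xl).
Qed.

Lemma route_cat p c q c' r : route p c q -> route q c' r -> route p (c ++ c') r.
Proof.
elim: c p => [|s c IH] p /=; first by move=> ->.
by move=> [? ? -> h] h'; split=> //; exact: IH.
Qed.

Definition rev_piece (s : piece) : piece := (s.1, (s.2.2, s.2.1)).

Lemma route_rev p c q : route p c q -> route q (rev (map rev_piece c)) p.
Proof.
elim: c p => [|s c IH] p /=; first by move=> ->.
move=> [? ? -> /IH h]; rewrite rev_cons -cats1.
by apply: route_cat h _; split.
Qed.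

Lemma route_len_cat c c' : route_len (c ++ c') = route_len c + route_len c'.
Proof. by rewrite /route_len big_cat. Qed.

Lemma route_len_rev c : route_len (rev (map rev_piece c)) = route_len c.
Proof.
elim: c => //= s c IH; rewrite rev_cons -cats1 route_len_cat IH.
by rewrite /route_len big_seq1 big_cons addrC/= distrC.
Qed.

Lemma route_len_ge0 c : 0 <= route_len c.
Proof. by apply: sumr_ge0. Qed.

Definition reach p q := exists c, route p c q.

Lemma reach_trans q p r : reach p q -> reach q r -> reach p r.
Proof. by move=> [c h] [c' h']; exists (c ++ c'); exact: route_cat h h'. Qed.

Lemma reach_sym p q : reach p q -> reach q p.
Proof. by move=> [c /route_rev h]; exists (rev (map rev_piece c)). Qed.

Lemma reach_arc a x y : 0 <= x <= len a -> 0 <= y <= len a ->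
  reach (along a x) (along a y).
Proof. by move=> hx hy; exists [:: (a, (x, y))]. Qed.

Lemma reach_node u v : reach (npoint u) (npoint v).
Proof.
have /connectP[p] := net_connected u v.
elim: p u => [|w p IH] u /=; first by move=> _ ->; exists [::].
move=> /andP[/existsP[a ha] hp] hv; apply: reach_trans (IH _ hp hv).
have h : reach (npoint (src a)) (npoint (dst a)).
  rewrite -along0 -along_len; apply: reach_arc; rewrite ?lexx ?ltW ?len_gt0//.
by case/orP: ha => /andP[/eqP <- /eqP <-]; [|exact: reach_sym].
Qed.

Lemma reach_any p q : reach p q.
Proof.
suff H r : exists v, reach r (npoint v).
  have [[u hu] [v hv]] := (H p, H q).
  by apply: reach_trans hu (reach_trans (reach_node u v) (reach_sym hv)).
case: r => [v|r]; first by exists v; exists [::].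
exists (src (val r).1); rewrite -along_inner -along0.
have /andP[r0 r1] := valP r.
by apply: reach_arc; rewrite ?lexx ?ltW ?len_gt0.
Qed.

Let dist_set p q := [set route_len c | c in [set c | route p c q]].

Let dist_has_inf p q : has_inf (dist_set p q).
Proof.
split; first by have [c hc] := reach_any p q; exists (route_len c), c.
by exists 0 => _ [c _ <-]; exact: route_len_ge0.
Qed.

Lemma sp_dist_le p c q : route p c q -> sp_dist p q <= route_len c.
Proof. by move=> h; apply: ge_inf; [case: (dist_has_inf p q)|exists c]. Qed.

Lemma sp_dist_ge0 p q : 0 <= sp_dist p q.
Proof.
apply: lb_le_inf; first by case: (dist_has_inf p q).
by move=> _ [c _ <-]; exact: route_len_ge0.
Qed.

Lemma sp_distxx p : sp_dist p p = 0.
Proof.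
apply/eqP; rewrite eq_le sp_dist_ge0 andbT.
have := @sp_dist_le p [::] p erefl.
by rewrite /route_len big_nil.
Qed.

Lemma sp_dist_sym p q : sp_dist p q = sp_dist q p.
Proof.
suff H (s t : netpoint) : sp_dist s t <= sp_dist t s by apply/eqP; rewrite eq_le !H.
apply: lb_le_inf; first by case: (dist_has_inf t s).
by move=> _ [c /route_rev/sp_dist_le h <-]; rewrite route_len_rev in h.
Qed.

Lemma sp_dist_triangle q p r : sp_dist p r <= sp_dist p q + sp_dist q r.
Proof.
rewrite -lerBlDr; apply: lb_le_inf; first by case: (dist_has_inf p q).
move=> _ [c hc <-]; rewrite lerBlDr addrC -lerBlDr.
apply: lb_le_inf; first by case: (dist_has_inf q r).
move=> _ [c' hc' <-]; rewrite lerBlDr addrC -route_len_cat.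
exact: sp_dist_le (route_cat hc hc').
Qed.

Lemma sp_dist_along a x y : sp_dist (along a x) (along a y) <= `|x - y|.
Proof.
have [x' hx' [-> ex]] := along_clamp a x.
have [y' hy' [-> ey]] := along_clamp a y.
have /sp_dist_le : route (along a x') [:: (a, (x', y'))] (along a y') by [].
rewrite /route_len big_seq1/= => /le_trans; apply.
have la := len_gt0 a; rewrite ex ey.
have h1 : x - y <= `|x - y| := ler_norm _.
have h2 : y - x <= `|x - y| by rewrite distrC ler_norm.
rewrite ler_norml; move: `|x - y| h1 h2 => N h1 h2.
case: (lerP 0 x) => ?; case: (lerP 0 y) => ?; case: (lerP (len a) x) => ?;
  case: (lerP (len a) y) => ?; case: (lerP (len a) 0) => ?; apply/andP; split; lra.
Qed.

(* A function on the network that is 1-Lipschitz along every arc bounds the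
   distance from below. *)
Lemma sp_dist_lb (f : netpoint -> R) :
  (forall a x y, 0 <= x <= len a -> 0 <= y <= len a ->
    f (along a x) - f (along a y) <= `|x - y|) ->
  forall p q, f p - f q <= sp_dist p q.
Proof.
move=> flip p q; apply: lb_le_inf; first by case: (dist_has_inf p q).
move=> _ [c hc <-]; elim: c p hc => [|s c IH] p /=.
  by move=> ->; rewrite subrr route_len_ge0.
move=> [h1 h2 -> /IH h]; rewrite /route_len big_cons.
have := flip _ _ _ h1 h2; rewrite -/(route_len c); lra.
Qed.


Definition glue_fun (g : node Q -> R) (h : arc Q -> R -> R) (p : netpoint) : R :=
  match p with inl v => g v | inr i => h (val i).1 (val i).2 end.

Lemma glue_funE g h a x : h a 0 = g (src a) -> h a (len a) = g (dst a) ->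
  0 <= x <= len a -> glue_fun g h (along a x) = h a x.
Proof.
move=> h0 h1 /andP[x0 x1].
move: x0; rewrite le_eqVlt => /predU1P[<-|x0]; first by rewrite along0.
move: x1; rewrite le_eqVlt => /predU1P[->|x1]; first by rewrite along_len.
rewrite /along; case: insubP => [u _ /= e|]; first by rewrite e.
by rewrite /= x0 x1.
Qed.

Let min_len : R := \big[Num.min/1]_(a : arc Q) len a.

Let min_len_gt0 : 0 < min_len.
Proof. by apply: lt_bigmin => // a _; exact: len_gt0. Qed.

Let min_len_le a : min_len <= len a.
Proof. exact: bigmin_le_cond. Qed.

Lemma npoint_sep u v : sp_dist (npoint u) (npoint v) = 0 -> u = v.
Proof.
move=> d0; apply/eqP/negPn/negP => uv.
pose b (w : node Q) : R := (w == u)%:R.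
pose g w := min_len * b w.
pose h a x := min_len * (b (src a) + (b (dst a) - b (src a)) * (x / len a)).
have la a : len a != 0 by rewrite gt_eqF// len_gt0.
have hs a : h a 0 = g (src a) by rewrite /h /g mul0r mulr0 addr0.
have hd a : h a (len a) = g (dst a) by rewrite /h /g divff// mulr1 addrC subrK.
suff /sp_dist_lb/(_ (npoint u) (npoint v)) : forall a x y,
    0 <= x <= len a -> 0 <= y <= len a ->
    glue_fun g h (along a x) - glue_fun g h (along a y) <= `|x - y|.
  by rewrite d0 /= /g /b eqxx eq_sym (negPf uv) mulr0 mulr1 subr0 leNgt min_len_gt0.
move=> a x y hx hy; rewrite !glue_funE//.
have -> : h a x - h a y =
    (b (dst a) - b (src a)) * (min_len / len a) * (x - y) by rewrite /h; field.
apply: le_trans (ler_norm _) _; rewrite !normrM; apply: ler_piMl => //.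
apply: mulr_ile1 => //.
  by rewrite /b; do 2 case: eqP => _; rewrite ?subrr ?subr0 ?sub0r ?normrN ?normr0 ?normr1.
have q0 : 0 <= min_len / len a by rewrite divr_ge0 // ltW // len_gt0.
rewrite -normrM ger0_norm//.
by rewrite ler_pdivrMr ?len_gt0// mul1r.
Qed.

Lemma inner_sep (i : inner_point) q : sp_dist (inr i) q = 0 -> inr i = q.
Proof.
case: i => -[a0 x0]/= hx0 d0; set i := exist _ _ _.
have /andP[x00 x0l] := hx0; rewrite /= in x00 x0l.
set r := Num.min x0 (len a0 - x0).
have r0 : 0 < r by rewrite lt_min x00 subr_gt0.
have rx : r <= x0 by rewrite ge_min lexx.
have rl : r <= len a0 - x0 by rewrite ge_min lexx orbT.
pose t y := Num.max 0 (r - `|y - x0|).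
pose h a x := if a == a0 then t x else 0.
have tx0 : t x0 = r by rewrite /t subrr normr0 subr0 max_r// ltW.
have t0 : t 0 = 0 by rewrite /t sub0r normrN gtr0_norm// max_l// subr_le0.
have tl : t (len a0) = 0.
  by rewrite /t gtr0_norm ?subr_gt0// max_l// subr_le0.
have hs a : h a 0 = 0 by rewrite /h; case: eqP.
have hd a : h a (len a) = 0 by rewrite /h; case: eqP => // ->.
have hlip a x y : h a x - h a y <= `|x - y|.
  rewrite /h; case: ifP => _; last by rewrite subrr.
  have h1 := ler_distD x y x0; rewrite (distrC y x) in h1.
  have h2 : 0 <= `|x - y| by [].
  rewrite /t; move: `|x - y| `|x - x0| `|y - x0| h1 h2 => N A B h1 h2.
  by case: (lerP 0 (r - A)) => ?; case: (lerP 0 (r - B)) => ?; lra.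
have flip a x y : 0 <= x <= len a -> 0 <= y <= len a ->
    glue_fun (fun=> 0) h (along a x) - glue_fun (fun=> 0) h (along a y) <= `|x - y|.
  by move=> hx hy; rewrite !glue_funE.
have /= := sp_dist_lb flip (inr i) q.
rewrite d0 {1}/h eqxx tx0 {flip hlip d0}.
case: q => [v|[[b y] hy]]/=; first by rewrite subr0 leNgt r0.
rewrite /h/=; case: eqP => [bE|_]; last by rewrite subr0 leNgt r0.
subst b; rewrite subr_le0 /t le_max leNgt r0/= lerDl oppr_ge0 normr_le0 subr_eq0.
by move=> /eqP e; congr inr; apply/val_inj => /=; rewrite e.
Qed.

Lemma sp_dist_positivity p q : sp_dist p q = 0 -> p = q.
Proof.
case: p => [u|i]; last exact: inner_sep.
case: q => [v|j]; first by move=> /npoint_sep->.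
by rewrite sp_dist_sym => /inner_sep.
Qed.

HB.instance Definition _ := isMetric.Build R netpoint
  sp_distxx sp_dist_positivity sp_dist_sym sp_dist_triangle.

HB.instance Definition _ :=
  isPointed.Build netpoint (npoint (src (enum_val (Ordinal (has_arc Q))))).

Definition point_display : measure_display. Proof. exact. Qed.

HB.instance Definition _ := @isMeasurable.Build point_display netpoint
  <<s (@open netpoint) >> (@sigma_algebra0 _ setT _) (@sigma_algebraC _ _)
  (@sigma_algebra_bigcup _ setT _).

End Points.

Section Length.
Variables (R : realType) (Q : network R).

Lemma measurable_lip (f : R -> netpoint Q) :
  (forall x y, mdist (f x) (f y) <= `|x - y|) -> measurable_fun [set: R] f.
Proof.
move=> flip; apply: (@measurability _ _ _ _ _ _ (@open (netpoint Q))) => //.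
move=> _ [U oU <-]; rewrite setTI; apply: open_measurable.
rewrite openE => x /= Ux.
have /nbhs_ballP[e e0 he] : nbhs (f x) U by exact: open_nbhs_nbhs.
apply/nbhs_ballP; exists e => // y xy /=; apply: he.
by rewrite ballEmdist/=; apply: le_lt_trans (flip x y) xy.
Qed.

Lemma measurable_along (a : arc Q) :
  measurable_fun [set: R] (along a : R -> netpoint Q).
Proof. by apply: measurable_lip => x y; exact: sp_dist_along. Qed.

Lemma semi_sigma_additive_preimage d1 d2 (T1 : measurableType d1)
    (T2 : measurableType d2) (m : {measure set T1 -> \bar R}) (f : T1 -> T2) :
  measurable_fun [set: T1] f -> semi_sigma_additive (fun A => m (f @^-1` A)).
Proof.
move=> mf F mF tF mUF; rewrite preimage_bigcup.
apply: measure_semi_sigma_additive.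
- by move=> n; rewrite -[X in measurable X]setTI; exact: mf.
- apply/trivIsetP => /= i j _ _ ij; rewrite -preimage_setI.
  by move/trivIsetP : tF => /(_ _ _ _ _ ij) ->//; rewrite preimage_set0.
- by rewrite -preimage_bigcup -[X in measurable X]setTI; exact: mf.
Qed.

Lemma semi_sigma_additive_fsum d (T : sigmaRingType d) (I : Type) (s : seq I)
    (m : I -> {measure set T -> \bar R}) :
  semi_sigma_additive (fun A => \sum_(i <- s) m i A)%E.
Proof.
move=> F mF tF mUF; rewrite [X in _ --> X](_ : _ =
    lim ((fun n => \sum_(0 <= i < n) \sum_(j <- s) m j (F i))%E @ \oo)).
  by apply: is_cvg_ereal_nneg_natsum => k _; exact: sume_ge0.
rewrite nneseries_sum//; apply: eq_bigr => /= i _.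
exact: measure_semi_bigcup.
Qed.

Definition arc_length (a : arc Q) (A : set (netpoint Q)) : \bar R :=
  lebesgue_measure (`]0, len a[ `&` along a @^-1` A).

Definition lambda (A : set (netpoint Q)) : \bar R :=
  (\sum_(a : arc Q) arc_length a A)%E.

Section ArcMeasure.
Variable a : arc Q.

Let arc_length0 : arc_length a set0 = 0%E.
Proof. by rewrite /arc_length preimage_set0 setI0 measure0. Qed.

Let arc_length_ge0 A : (0 <= arc_length a A)%E. Proof. exact: measure_ge0. Qed.

Let arc_length_sigma : semi_sigma_additive (arc_length a).
Proof.
move=> F mF tF mUF; rewrite /arc_length preimage_bigcup setI_bigcupr.
have mA n : measurable (`]0, len a[ `&` along a @^-1` F n).
  apply: measurableI => //; rewrite -[X in measurable X]setTI.
  exact: measurable_along.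
apply: measure_semi_sigma_additive => //; last exact: bigcupT_measurable.
apply/trivIsetP => /= i j _ _ ij; rewrite setIACA setIid -preimage_setI.
by move/trivIsetP : tF => /(_ _ _ _ _ ij) ->//; rewrite preimage_set0 setI0.
Qed.

HB.instance Definition _ := isMeasure.Build _ _ _ (arc_length a)
  arc_length0 arc_length_ge0 arc_length_sigma.

End ArcMeasure.

Let lambda0 : lambda set0 = 0%E.
Proof. by rewrite /lambda big1. Qed.

Let lambda_ge0 A : (0 <= lambda A)%E.
Proof. exact: sume_ge0. Qed.

Let lambda_sigma : semi_sigma_additive lambda.
Proof. exact: semi_sigma_additive_fsum. Qed.

HB.instance Definition _ := isMeasure.Build _ _ _ lambda
  lambda0 lambda_ge0 lambda_sigma.

Definition mu : R := fine (lambda [set: netpoint Q]).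

Lemma lambdaT : lambda [set: netpoint Q] = (\sum_(a : arc Q) len a)%:E.
Proof.
rewrite -sumEFin; apply: eq_bigr => a _.
rewrite /arc_length preimage_setT setIT lebesgue_measure_itv/= lte_fin.
by rewrite len_gt0 oppr0 adde0.
Qed.

Lemma lambdaT_gt0 : (0 < lambda [set: netpoint Q])%E.
Proof.
pose a := enum_val (Ordinal (has_arc Q)).
rewrite lambdaT lte_fin (bigD1 a)//= ltr_pwDl ?len_gt0//.
by apply: sumr_ge0 => b _; exact/ltW/len_gt0.
Qed.

Lemma lambda_fin A : measurable A -> lambda A \is a fin_num.
Proof.
move=> mA; rewrite ge0_fin_numE//; apply: (@le_lt_trans _ _ (lambda setT)).
  by apply: le_measure; rewrite ?inE//.
by rewrite lambdaT ltry.
Qed.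

End Length.
Arguments lambda {R Q}.

Section Game.
Variables (R : realType) (Q : network R).

Definition time : Type := {nonneg R}.

HB.instance Definition _ := Choice.on time.
HB.instance Definition _ := isPointed.Build time (0%:nng : {nonneg R}).

Definition time_val (t : time) : R := t%:num.

Definition time_display : measure_display. Proof. exact. Qed.

HB.instance Definition _ := @isMeasurable.Build time_display time
  <<s preimage_set_system setT time_val measurable >>
  (@sigma_algebra0 _ setT _) (@sigma_algebraC _ _)
  (@sigma_algebra_bigcup _ setT _).

Record patrol := Patrol {
  position :> time -> netpoint Q;
  unit_speed : forall t t' : time,
    mdist (position t) (position t') <= `|time_val t - time_val t'| }.

HB.instance Definition _ := gen_eqMixin patrol.
HB.instance Definition _ := gen_choiceMixin patrol.

Let still : patrol.
Proof. by exists (fun=> point) => t t'; rewrite mdistxx. Defined.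

HB.instance Definition _ := isPointed.Build patrol still.

Definition patrol_display : measure_display. Proof. exact. Qed.

(* The sigma-algebra of a mixed patrol is the one generated by the positions
   at each time; since patrols are 1-Lipschitz it is the Borel sigma-algebra of
   uniform convergence on bounded intervals. *)
HB.instance Definition _ := @isMeasurable.Build patrol_display patrol
  <<s \bigcup_t preimage_set_system setT (fun S : patrol => S t) measurable >>
  (@sigma_algebra0 _ setT _) (@sigma_algebraC _ _)
  (@sigma_algebra_bigcup _ setT _).

Definition attack : Type := (netpoint Q * time)%type.

Variable alpha : {posnum R}.

Definition intercepts (S : patrol) (x : attack) : Prop :=
  exists2 t : time,
    time_val x.2 <= time_val t <= time_val x.2 + alpha%:num & S t = x.1.

Definition payoff (P : probability patrol R) (A : probability attack R) : \bar R :=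
  (P \x A)%E [set z | intercepts z.1 z.2].

Definition lower_value : \bar R :=
  ereal_sup (range (fun P => ereal_inf (range (payoff P)))).

Definition upper_value : \bar R :=
  ereal_inf (range (fun A => ereal_sup (range (payoff ^~ A)))).

Definition is_value (v : \bar R) : Prop := lower_value = v /\ upper_value = v.

Definition patroller_optimal (P : probability patrol R) : Prop :=
  ereal_inf (range (payoff P)) = lower_value.

Definition attacker_optimal (A : probability attack R) : Prop :=
  ereal_sup (range (payoff ^~ A)) = upper_value.

End Game.

Section ClosedPaths.
Variables (R : realType) (Q : network R).

(* Only the values of trace on [0, period] matter. *)
Record closed_path := ClosedPath {
  trace :> R -> netpoint Q;
  period : R;
  period_gt0 : 0 < period;
  trace_closed : trace 0 = trace period;
  trace_lip : forall s t, 0 <= s <= period -> 0 <= t <= period ->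
    mdist (trace s) (trace t) <= `|s - t| }.

Definition covering (c : closed_path) : Prop :=
  forall x, exists2 t, 0 <= t <= period c & c t = x.

Definition min_cover : \bar R :=
  ereal_inf [set (period c)%:E | c in [set c | covering c]].

Definition wrap (L x : R) : R := x - L * (Num.floor (x / L))%:~R.

Lemma wrap_itv (L x : R) : 0 < L -> 0 <= wrap L x < L.
Proof.
move=> L0; rewrite /wrap.
have /andP[h1 h2] := floor_itv (x / L).
rewrite ler_pdivlMr// in h1; rewrite ltr_pdivrMr// intrD mulrDl in h2.
by apply/andP; split; lra.
Qed.

Lemma trace_wrap_lip (c : closed_path) (s t : R) :
  mdist (c (wrap (period c) s)) (c (wrap (period c) t)) <= `|s - t|.
Proof.
wlog st : s t / s <= t => [hw|].
  have [st|ts] := orP (le_total s t); first exact: hw.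
  by rewrite metric_sym distrC; exact: hw.
have L0 := period_gt0 c.
have /andP[s0 s1] := wrap_itv s L0; have /andP[t0 t1] := wrap_itv t L0.
have sb : 0 <= wrap (period c) s <= period c by rewrite s0 ltW.
have tb : 0 <= wrap (period c) t <= period c by rewrite t0 ltW.
have b0 : 0 <= (0 : R) <= period c by rewrite lexx ltW.
have b1 : 0 <= period c <= period c by rewrite lexx ltW.
rewrite distrC (ger0_norm (_ : 0 <= t - s)) ?subr_ge0//.
have : (Num.floor (s / period c) <= Num.floor (t / period c))%R.
  by apply: le_floor; rewrite ler_pM2r ?invr_gt0.
rewrite le_eqVlt => /predU1P[e|].
  apply: le_trans (trace_lip sb tb) _; rewrite /wrap e.
  by rewrite ler_norml; apply/andP; split; lra.
rewrite -lezD1 -(ler_int R) intrD => k.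
have k' : period c * (Num.floor (s / period c))%:~R + period c <=
    period c * (Num.floor (t / period c))%:~R.
  by rewrite -[X in _ + X]mulr1 -mulrDr ler_pM2l.
have h1 : mdist (c (wrap (period c) s)) (c (period c)) <=
    period c - wrap (period c) s.
  apply: le_trans (trace_lip sb b1) _.
  by rewrite ler0_norm ?opprB// subr_le0 ltW.
have h2 : mdist (c 0) (c (wrap (period c) t)) <= wrap (period c) t.
  apply: le_trans (trace_lip b0 tb) _.
  by rewrite sub0r normrN ger0_norm.
rewrite trace_closed in h2.
have h3 := metric_triangle (c (wrap (period c) s)) (c (period c))
  (c (wrap (period c) t)).
apply: le_trans h3 _; apply: le_trans (lerD h1 h2) _.
rewrite /wrap; lra.
Qed.

Definition shifted_patrol (c : closed_path) (D : R) : patrol Q.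
Proof.
exists (fun t => c (wrap (period c) (time_val t + D))) => t t'.
by apply: le_trans (trace_wrap_lip _ _ _) _; rewrite opprD addrACA subrr addr0.
Defined.

Lemma measurable_shifted_patrol c : measurable_fun [set: R] (shifted_patrol c).
Proof.
apply: (@measurability _ _ _ _ _ _ (\bigcup_t
  preimage_set_system setT (fun S : patrol Q => S t) measurable)) => //.
move=> _ [_ [t _ [B mB <-]] <-]; rewrite !setTI.
have mf : measurable_fun [set: R]
    (fun D => c (wrap (period c) (time_val t + D))).
  apply: measurable_lip => x y; apply: le_trans (trace_wrap_lip _ _ _) _.
  by rewrite opprD addrACA subrr add0r.
by rewrite -[X in measurable X]setTI; exact: mf.
Qed.

(* The law of the patrol t |-> c ((t + D) mod L), D uniform on [0, L], where L
   is the period of c. *)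
Definition random_extension (c : closed_path) (A : set (patrol Q)) : \bar R :=
  uniform_prob (period_gt0 c) (shifted_patrol c @^-1` A).

Section RandomExtension.
Variable c : closed_path.

Let re0 : random_extension c set0 = 0%E.
Proof. by rewrite /random_extension preimage_set0 measure0. Qed.

Let re_ge0 A : (0 <= random_extension c A)%E. Proof. exact: measure_ge0. Qed.

Let re_sigma : semi_sigma_additive (random_extension c).
Proof.
apply: (@semi_sigma_additive_preimage _ _ _ _ _ (uniform_prob (period_gt0 c))).
exact: measurable_shifted_patrol.
Qed.

HB.instance Definition _ := isMeasure.Build _ _ _ (random_extension c)
  re0 re_ge0 re_sigma.

Let reT : random_extension c [set: patrol Q] = 1%E.
Proof. by rewrite /random_extension preimage_setT probability_setT. Qed.

HB.instance Definition _ :=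
  Measure_isProbability.Build _ _ _ (random_extension c) reT.

End RandomExtension.

End ClosedPaths.

Section Tours.
Variables (R : realType) (Q : network R).

(* (a, true) is the arc a traversed from src a to dst a, (a, false) the same
   arc traversed backwards. *)
Definition darc : Type := (arc Q * bool)%type.

Definition dstart (e : darc) : node Q := if e.2 then src e.1 else dst e.1.
Definition dend (e : darc) : node Q := if e.2 then dst e.1 else src e.1.

Definition consecutive (e e' : darc) : bool := dend e == dstart e'.

Definition circuit (w : seq darc) : bool :=
  [&& w != [::], cycle consecutive w & uniq [seq e.1 | e <- w]].

Definition girth : \bar R :=
  ereal_inf ([set (\sum_(e <- w) len e.1)%:E | w in [set w | circuit w]] `|`
             [set (2 * len a)%:E | a in [set a : arc Q | leaf_arc a]]).

Definition reversal (e e' : darc) : bool := (e'.1 == e.1) && (e'.2 != e.2).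

(* A closed path is given by the cyclic sequence of the directed arcs that it
   traverses, so the last one is followed by the first one. *)
Definition double_tour (w : seq darc) : bool :=
  [&& cycle consecutive w,
      cycle (fun e e' => reversal e e' ==> leaf_arc e.1) w
    & [forall a, count (fun e : darc => e.1 == a) w == 2%N]].

Section Follow.
Variable beta : {nonneg R}.

Definition pause (e : darc) : R := if leaf (dend e) then beta%:num else 0.

(* Position at time t on the unit speed path that follows w from the point p,
   waiting for a time beta each time it reaches a leaf node. *)
Fixpoint follow (w : seq darc) (p : netpoint Q) (t : R) : netpoint Q :=
  match w with
  | [::] => p
  | e :: w' =>
      if t <= len e.1 then along e.1 (if e.2 then t else len e.1 - t)
      else if t <= len e.1 + pause e then npoint (dend e)
      else follow w' (npoint (dend e)) (t - (len e.1 + pause e))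
  end.

Definition follow_time (w : seq darc) : R := \sum_(e <- w) (len e.1 + pause e).

Lemma pause_ge0 e : 0 <= pause e.
Proof. by rewrite /pause; case: ifP. Qed.

Lemma follow0 e w p : follow (e :: w) p 0 = npoint (dstart e).
Proof.
rewrite /= ltW ?len_gt0// /dstart subr0.
by case: ifP; rewrite ?along0 ?along_len.
Qed.

Lemma along_dend (e : darc) :
  along e.1 (if e.2 then len e.1 else len e.1 - len e.1) = npoint (dend e).
Proof. by rewrite subrr /dend; case: ifP; rewrite ?along0 ?along_len. Qed.

Lemma follow_start e w : path consecutive e w ->
  follow w (npoint (dend e)) 0 = npoint (dend e).
Proof.
by case: w => // e' w hw; rewrite follow0; case/andP: hw => /eqP->.
Qed.

Lemma follow_step e w p : path consecutive e w ->
  (forall s t, s <= t -> mdist (follow w (npoint (dend e)) s)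
                               (follow w (npoint (dend e)) t) <= t - s) ->
  forall s t, s <= t ->
    mdist (follow (e :: w) p s) (follow (e :: w) p t) <= t - s.
Proof.
move=> /follow_start; set m := npoint (dend e) => g0 gl s t st.
have l0 := len_gt0 e.1; have q0 := pause_ge0 e.
pose f x := along e.1 (if e.2 then x else len e.1 - x).
have fl x y : mdist (f x) (f y) <= `|x - y|.
  apply: le_trans (sp_dist_along _ _ _) _; case: ifP => // _.
  by rewrite [X in `|X|](_ : _ = y - x) ?(distrC y)//; lra.
have fm x : x <= len e.1 -> mdist (f x) m <= len e.1 - x.
  move=> xl; rewrite /m -along_dend; apply: le_trans (fl x (len e.1)) _.
  by rewrite distrC ger0_norm ?subr_ge0.
have gm x : 0 <= x -> mdist m (follow w m x) <= x.
  by move=> /gl; rewrite g0 subr0.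
rewrite /= -/m -/(f s) -/(f t).
have [sl|sl] := leP s (len e.1).
  have h1 := fm _ sl; have [tl|tl] := leP t (len e.1).
    apply: le_trans (fl s t) _; rewrite distrC ger0_norm ?subr_ge0//.
  have [tp|tp] := leP t (len e.1 + pause e); first by apply: le_trans h1 _; lra.
  apply: le_trans (metric_triangle _ m _) _.
  have /gm h2 : 0 <= t - (len e.1 + pause e) by lra.
  by apply: le_trans (lerD h1 h2) _; lra.
rewrite (lt_geF (lt_le_trans sl st)).
have [sp|sp] := leP s (len e.1 + pause e).
  have [tp|tp] := leP t (len e.1 + pause e); first by rewrite mdistxx subr_ge0.
  have /gm h2 : 0 <= t - (len e.1 + pause e) by lra.
  by apply: le_trans h2 _; lra.
rewrite (lt_geF (lt_le_trans sp st)).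
have /gl h : s - (len e.1 + pause e) <= t - (len e.1 + pause e) by lra.
by apply: le_trans h _; lra.
Qed.

Lemma follow_lip e w p s t : path consecutive e w -> s <= t ->
  mdist (follow (e :: w) p s) (follow (e :: w) p t) <= t - s.
Proof.
elim: w e p s t => [|e' w IH] e p s t hw st; apply: follow_step => //.
  by move=> x y xy; rewrite mdistxx subr_ge0.
by move=> x y xy; apply: IH => //; case/andP: hw.
Qed.

Lemma follow_end e w p : path consecutive e w ->
  follow (e :: w) p (follow_time (e :: w)) = npoint (dend (last e w)).
Proof.
elim: w e p => [|e' w IH] e p.
  move=> _; rewrite /follow_time big_seq1/= lexx.
  case: ifP => //; rewrite gerDl => q0.
  have -> : pause e = 0 by apply/le_anti; rewrite q0 pause_ge0.
  by rewrite addr0 along_dend.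
move=> /= /andP[_ hw]; rewrite /follow_time big_cons -/(follow_time (e' :: w)).
have T0 : 0 < follow_time (e' :: w).
  rewrite /follow_time big_cons; apply: ltr_pwDl.
    by apply: ltr_pwDl; rewrite ?len_gt0 ?pause_ge0.
  by apply: sumr_ge0 => x _; rewrite addr_ge0 ?pause_ge0 ?ltW ?len_gt0.
have q0 := pause_ge0 e.
have h : len e.1 + pause e < len e.1 + pause e + follow_time (e' :: w).
  by rewrite ltrDl.
rewrite (lt_geF h) (lt_geF (le_lt_trans _ h)) ?lerDl//.
by rewrite addrC addKr; exact: IH.
Qed.

End Follow.

Lemma arc_tour_neq0 w : double_tour w -> w != [::].
Proof.
case/and3P => _ _ /forallP/(_ (enum_val (Ordinal (has_arc Q)))).
by apply: contraTneq => ->.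
Qed.

Section TourPath.
Variables (beta : {nonneg R}) (w : seq darc).
Hypothesis tour_w : double_tour w.

Let T := follow_time beta w.
Let origin : netpoint Q :=
  if w is e :: _ then npoint (dstart e) else point.
Let f := follow beta w origin.

Let T_gt0 : 0 < T.
Proof.
rewrite /T; case: w tour_w => [/arc_tour_neq0//|e w' _].
rewrite /follow_time big_cons; apply: ltr_pwDl.
  by apply: ltr_pwDl; rewrite ?len_gt0 ?pause_ge0.
by apply: sumr_ge0 => x _; rewrite addr_ge0 ?pause_ge0 ?ltW ?len_gt0.
Qed.

Let f_closed : f 0 = f T.
Proof.
rewrite /f /T /origin; case: w tour_w => [/arc_tour_neq0//|e w'] /and3P[+ _ _].
rewrite /= rcons_path => /andP[hw /eqP he].
by rewrite [RHS]follow_end// he [LHS]follow0.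
Qed.

Let f_lip s t : 0 <= s <= T -> 0 <= t <= T -> mdist (f s) (f t) <= `|s - t|.
Proof.
move=> _ _; wlog st : s t / s <= t => [hw|].
  have [st|ts] := orP (le_total s t); first exact: hw.
  by rewrite metric_sym distrC; exact: hw.
rewrite distrC ger0_norm ?subr_ge0// /f.
case: w tour_w => [/arc_tour_neq0//|e w'] /and3P[+ _ _].
by rewrite /= rcons_path => /andP[hw _]; exact: follow_lip.
Qed.

(* The tour w itself when beta is 0; with a stop of length beta at each visit
   to a leaf node otherwise. *)
Definition tour_path : closed_path Q := ClosedPath T_gt0 f_closed f_lip.

End TourPath.

End Tours.

Section IndependentAttack.
Variables (R : realType) (Q : network R) (alpha : {posnum R}).
Implicit Type I : {fset (netpoint Q)}.

Definition independent I : Prop :=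
  forall x y, x \in I -> y \in I -> x != y -> alpha%:num <= mdist x y.

Definition near_set I : set (netpoint Q) :=
  [set q | exists2 x, x \in I & mdist x q <= alpha%:num / 2].

Let max0_ge0 (x : R) : 0 <= Num.max 0 x. Proof. by rewrite le_max lexx. Qed.

Definition clock (x : R) : time R := NngNum (max0_ge0 x).

Lemma measurable_clock : measurable_fun [set: R] clock.
Proof.
apply: (@measurability _ _ _ _ _ _
  (preimage_set_system setT (@time_val R) measurable)) => //.
move=> _ [_ [B mB <-] <-]; rewrite !setTI.
have mf : measurable_fun [set: R] (fun x : R => Num.max 0 x).
  by apply: measurable_maxr => //; exact: measurable_id.
by rewrite -[X in measurable X]setTI; exact: mf.
Qed.

Lemma measurable_near_set I : measurable (near_set I).
Proof.
rewrite (_ : near_set I =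
    \bigcup_(x in [set` I]) ~` [set q | alpha%:num / 2 < mdist x q]).
  apply: fin_bigcup_measurable => // x _; apply: measurableC.
  apply: sub_sigma_algebra; rewrite openE => q /= hq.
  apply/nbhs_ballP; exists (mdist x q - alpha%:num / 2); first by rewrite /= subr_gt0.
  move=> y; rewrite ballEmdist/= => qy.
  by have := metric_triangle x y q; rewrite (metric_sym y q); lra.
apply/seteqP; split=> q /=.
  by move=> [x xI xq]; exists x => //=; apply/negP; rewrite -leNgt.
by move=> [x xI /negP]; rewrite -leNgt => xq; exists x.
Qed.

Definition far_length I : R := fine (lambda (~` near_set I)).

Definition point_prob I : R :=
  #|` I|%:R * alpha%:num / (far_length I + #|` I|%:R * alpha%:num).

Definition attack_at (x : netpoint Q) (A : set (attack Q)) : \bar R :=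
  uniform_prob [gt0 of alpha%:num] [set t | A (x, clock t)].

Definition attack_far I (A : set (attack Q)) : \bar R :=
  lambda ([set x | A (x, clock (alpha%:num / 2))] `&` ~` near_set I).

(* When I is empty the first term vanishes and point_prob I is 0; when the
   complement of near_set I has length 0, point_prob I is 1 and the second
   term vanishes. *)
Definition independent_attack I (A : set (attack Q)) : \bar R :=
  ((point_prob I / #|` I|%:R)%:E * (\sum_(x <- I) attack_at x A)
   + ((1 - point_prob I) / far_length I)%:E * attack_far I A)%E.

Section AttackAt.
Variable x : netpoint Q.

Let aa0 : attack_at x set0 = 0%E. Proof. exact: measure0. Qed.

Let aa_ge0 A : (0 <= attack_at x A)%E. Proof. exact: measure_ge0. Qed.

Let aa_sigma : semi_sigma_additive (attack_at x).
Proof.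
apply: (@semi_sigma_additive_preimage _ _ _ _ _ (uniform_prob [gt0 of alpha%:num])
  (fun t => (x, clock t))).
apply: measurable_fun_pair => //; exact: measurable_clock.
Qed.

HB.instance Definition _ := isMeasure.Build _ _ _ (attack_at x)
  aa0 aa_ge0 aa_sigma.

Lemma attack_atT : attack_at x setT = 1%E.
Proof. exact: probability_setT. Qed.

End AttackAt.

Section AttackFar.
Variable I : {fset (netpoint Q)}.

Let af0 : attack_far I set0 = 0%E.
Proof. by rewrite /attack_far set0I measure0. Qed.

Let af_ge0 A : (0 <= attack_far I A)%E. Proof. exact: measure_ge0. Qed.

Let af_sigma : semi_sigma_additive (attack_far I).
Proof.
pose m : {measure set (netpoint Q) -> \bar R} :=
  mrestr lambda (measurableC (measurable_near_set I)).
apply: (@semi_sigma_additive_preimage _ _ _ _ _ m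
  (fun x => (x, clock (alpha%:num / 2)))).
exact: measurable_fun_pair.
Qed.

HB.instance Definition _ := isMeasure.Build _ _ _ (attack_far I)
  af0 af_ge0 af_sigma.

Lemma attack_farT : attack_far I setT = (far_length I)%:E.
Proof.
rewrite /attack_far /far_length fineK ?setTI//.
by apply: lambda_fin; apply: measurableC; exact: measurable_near_set.
Qed.

End AttackFar.

Section IndependentAttackMeasure.
Variable I : {fset (netpoint Q)}.
Let l : R := #|` I|%:R.
Let m := far_length I.
Let p := point_prob I.

Let l_ge0 : 0 <= l. Proof. exact: ler0n. Qed.
Let m_ge0 : 0 <= m. Proof. exact/fine_ge0/measure_ge0. Qed.
Let la_ge0 : 0 <= l * alpha%:num. Proof. exact: mulr_ge0. Qed.

Let p_ge0 : 0 <= p.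
Proof. by rewrite /p /point_prob divr_ge0// addr_ge0. Qed.

Let p_le1 : p <= 1.
Proof.
rewrite /p /point_prob -/l -/m; have [->|d0] := eqVneq (m + l * alpha%:num) 0.
  by rewrite invr0 mulr0.
by rewrite ler_pdivrMr ?mul1r ?lerDr// lt0r d0 addr_ge0.
Qed.

Let c1 : {nonneg R} := NngNum (divr_ge0 p_ge0 l_ge0).

Let q_ge0 : 0 <= (1 - p) / m.
Proof. by rewrite divr_ge0// subr_ge0. Qed.

Let c2 : {nonneg R} := NngNum q_ge0.

Let ia0 : independent_attack I set0 = 0%E.
Proof. by rewrite /independent_attack big1// measure0 !mule0 adde0. Qed.

Let ia_ge0 A : (0 <= independent_attack I A)%E.
Proof.
apply: adde_ge0; apply: mule_ge0.
- by rewrite lee_fin; exact: divr_ge0.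
- exact: sume_ge0.
- by rewrite lee_fin.
- exact: measure_ge0.
Qed.

Let points (A : set (attack Q)) := (\sum_(x <- I) attack_at x A)%E.

Let points0 : points set0 = 0%E. Proof. by rewrite /points big1. Qed.
Let points_ge0 A : (0 <= points A)%E. Proof. exact: sume_ge0. Qed.
Let points_sigma : semi_sigma_additive points.
Proof. exact: semi_sigma_additive_fsum. Qed.

HB.instance Definition _ := isMeasure.Build _ _ _ points
  points0 points_ge0 points_sigma.

Let ia_sigma : semi_sigma_additive (independent_attack I).
Proof.
rewrite (_ : independent_attack I =
    measure_add (mscale c1 points) (mscale c2 (attack_far I))); last first.
  by apply/funext => A; rewrite measure_addE.
exact: measure_semi_sigma_additive.
Qed.

HB.instance Definition _ := isMeasure.Build _ _ _ (independent_attack I)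
  ia0 ia_ge0 ia_sigma.

Let iaT : independent_attack I setT = 1%E.
Proof.
rewrite /independent_attack attack_farT -/p -/l -/m.
rewrite (eq_bigr (fun=> 1%:E)); last by move=> x _; rewrite attack_atT.
rewrite sumEFin big_const_seq count_predT iter_addr addr0 -/l -!EFinM -EFinD.
congr EFin.
have [l0|l0] := eqVneq l 0.
  have I0 : I = fset0 by apply/eqP; rewrite -cardfs_eq0 -(eqr_nat R) -/l l0.
  have m0 : m != 0.
    rewrite /m /far_length (_ : ~` near_set I = setT).
      by rewrite fine_eq0 ?lambda_fin// gt_eqF// lambdaT_gt0.
    by apply/seteqP; split=> // q _ [x]; rewrite I0.
  by rewrite /p /point_prob -/l l0 !mul0r subr0 add0r divfK.
have lp : 0 < l by rewrite lt0r l0 l_ge0.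
rewrite divfK//.
have [m0|m0] := eqVneq m 0; last by rewrite divfK// addrC subrK.
by rewrite m0 mulr0 addr0 /p /point_prob -/l -/m m0 add0r divff// mulf_neq0.
Qed.

HB.instance Definition _ :=
  Measure_isProbability.Build _ _ _ (independent_attack I) iaT.

End IndependentAttackMeasure.

Definition leaf_nodes : {fset (netpoint Q)} :=
  [fset npoint v | v in [set v : node Q | leaf v]%SET]%fset.

End IndependentAttack.

(* Main.v *)
(* The two strategies guarantee the same number v, so both are optimal and v is
   the value.

   Patroller.  The tour of period T = 2 mu + l alpha is at every point x at two
   times that are at least alpha apart in both cyclic directions: a closed piece
   of the tour that never turns back contains a circuit, hence is at least as
   long as the girth, and a turn at a leaf comes with a stop of length alpha.
   Each of the two times accounts for a set of shifts of length alpha that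
   intercept a given attack at x.  A double tour is obtained by tracing the faces
   of a rotation system and then splicing closed walks with a common node.

   Attacker.  Against a patrol S, a start time t at which a leaf attack is
   intercepted has S (t + alpha / 2) near a leaf, and for almost all t at most
   one leaf is visited during [t, t + alpha].  As S is 1-Lipschitz, the length of
   what it covers far from the leaves is at most the time it spends there, so
   the intercepting times for the leaves and the length of the far region that
   is covered add up to at most alpha. *)
From mathcomp Require Import all_boot all_order all_algebra finmap ring lra.
From mathcomp Require Import all_classical all_reals all_analysis measurable_realfun.
Require Import Defs.

Set Implicit Arguments.
Unset Strict Implicit.
Unset Printing Implicit Defensive.

Import Order.TTheory GRing.Theory Num.Theory.
Import numFieldNormedType.Exports.
Local Open Scope classical_set_scope.
Local Open Scope ring_scope.

(** * Lebesgue measure and Lipschitz maps *)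

Section RealLipschitz.
Variable R : realType.
Local Notation leb := (@lebesgue_measure R).

(** Stated for arbitrary sets, through the outer measure behind [lebesgue_measure]: it is applied
    below to images of Lipschitz maps, whose measurability is never established. *)
Lemma le_lebesgue_measure (A B : set R) : A `<=` B -> (leb A <= leb B)%E.
Proof. exact: (le_outer_measure (mu_ext (@wlength R idfun))). Qed.

(** Each interval of an open cover of [B] is mapped by [f] into a closed interval of the same
    length, centred at the image of its midpoint, and these closed intervals cover [A]. *)
Lemma lebesgue_measure_lip (f : R -> R) (A B : set R) :
  (forall x y, `|f x - f y| <= `|x - y|) -> A `<=` f @` B ->
  (leb A <= leb B)%E.
Proof.
move=> flip AB; rewrite [leRHS](outer_measure_open_itv_cover B).
apply: le_ereal_inf_tmp => _ [F [Fitv BF] <-].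
pose c k := sval (cid (Fitv k)).
(* The end points attached to [F k] may come in the wrong order; then [F k] is empty, and [G k] must
   be empty too. *)
pose G k : set R := if (c k).1 < (c k).2 then
  `[f (((c k).1 + (c k).2) / 2) - ((c k).2 - (c k).1) / 2,
    f (((c k).1 + (c k).2) / 2) + ((c k).2 - (c k).1) / 2]%classic else set0.
have cE k : F k = `](c k).1, (c k).2[%classic by rewrite /c; case: cid.
have AG : A `<=` \bigcup_k G k.
  move=> _ /AB[x /BF[k _ Fkx] <-]; exists k => //.
  move: Fkx; rewrite cE /= in_itv/= /G => /andP[cx xc].
  rewrite (lt_trans cx xc)/= in_itv/= -ler_distl.
  apply: le_trans (flip _ _) _; rewrite ler_norml; apply/andP; split; lra.
apply: le_trans (le_lebesgue_measure AG) _.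
apply: le_trans (outer_measure_sigma_subadditive (mu_ext (@wlength R idfun)) G) _.
apply: lee_nneseries => [k _ _|k _]; first exact: outer_measure_ge0.
rewrite -[leLHS]/(leb (G k)) cE wlength_itv/= /G lte_fin.
case: ifPn => ab; last by rewrite measure0.
rewrite lebesgue_measure_itv/= lte_fin.
case: ifPn => _; rewrite -EFinD lee_fin; lra.
Qed.

Lemma lebesgue_measure_shift (c : R) (A B : set R) :
  (forall x, A x -> B (x + c)) -> (leb A <= leb B)%E.
Proof.
move=> AB; apply: (@lebesgue_measure_lip (fun x => x - c)) => [x y|x /AB Bx].
  by rewrite opprB addrA subrK.
by exists (x + c); rewrite ?addrK.
Qed.

End RealLipschitz.

(** * Interception as a measurable event *)

Section ProductProbability.
Variables (R : realType) (d1 d2 : measure_display).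
Variables (T1 : measurableType d1) (T2 : measurableType d2).
Variables (P : probability T1 R) (A : probability T2 R).
Variables (E : set (T1 * T2)) (v : R).
Hypothesis mE : measurable E.
Local Open Scope ereal_scope.

(** Integrating over the other player's choice turns a bound against every pure strategy into a
    bound against every mixed one. *)
Lemma product_probability_le :
  (forall x, A (xsection E x) <= v%:E) -> (P \x A) E <= v%:E.
Proof.
move=> Av; rewrite /product_measure1.
have -> : v%:E = \int[P]_x (cst v%:E) x.
  by rewrite integral_cst// [X in _ * X]probability_setT mule1.
apply: ge0_le_integral => //=; exact: (measurable_fun_xsection A).
Qed.

Lemma le_product_probability : (0 <= v)%R ->
  (forall y, v%:E <= P (ysection E y)) -> v%:E <= (P \x A) E.
Proof.
move=> v0 Pv.
(* The product measure is defined by integrating over the first factor; by uniqueness it is also the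
   integral over the second one. *)
rewrite (@product_measure_unique _ _ _ _ _ _ _ (P \x^ A))//; last first.
  by move=> B C mB mC /=; rewrite product_measure2E.
have -> : v%:E = \int[A]_x (cst v%:E) x.
  by rewrite integral_cst// [X in _ * X]probability_setT mule1.
apply: ge0_le_integral => //=; exact: (measurable_fun_ysection P).
Qed.

End ProductProbability.

Section Measurability.
Variables (R : realType) (Q : network R).

Lemma measurable_ball_metric (x : netpoint Q) (e : R) :
  measurable [set y | mdist x y < e].
Proof.
apply: sub_sigma_algebra; rewrite openE => q /= hq.
apply/nbhs_ballP; exists (e - mdist x q); first by rewrite /= subr_gt0.
move=> y; rewrite ballEmdist/= => qy.
by have := metric_triangle x q y; lra.
Qed.

Lemma measurable_position (t : time R) :
  measurable_fun [set: patrol Q] (fun S : patrol Q => S t).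
Proof.
move=> _ B mB; rewrite setTI; apply: sub_sigma_algebra.
by exists t => //; exists B => //; rewrite setTI.
Qed.

Lemma measurable_time_val : measurable_fun [set: time R] (@time_val R).
Proof.
move=> _ B mB; rewrite setTI; apply: sub_sigma_algebra.
by exists B => //; rewrite setTI.
Qed.

Lemma alongP (x : netpoint Q) :
  exists a, exists2 y, 0 <= y <= len a & x = along a y.
Proof.
case: x => [v|i]; last first.
  exists (val i).1, (val i).2; rewrite ?along_inner//.
  by case/andP: (valP i) => ? ?; rewrite !ltW.
(* A nonempty route from [v] begins on an arc through [v]; if the route is empty, [v] is itself the
   source of an arc. *)
have [c] := reach_any (npoint v) (npoint (src (enum_val (Ordinal (has_arc Q))))).
rewrite -[inl v]/(npoint v); case: c => [/= ->|s c [h1 h2 -> _]]; last by exists s.1, s.2.1.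
by eexists; exists 0; rewrite ?along0 ?lexx ?(ltW (len_gt0 _)).
Qed.

Lemma dense_rat (x e : R) : 0 < e -> exists q : rat, `|ratr q - x| < e.
Proof.
move=> e0; have /rat_in_itvoo[q] : x - e < x + e by lra.
rewrite in_itv/= => /andP[h1 h2]; exists q.
by rewrite ltr_norml; apply/andP; split; lra.
Qed.

Lemma time_val_clock (x : R) : time_val (clock x) = Num.max 0 x.
Proof. by []. Qed.

Lemma clock_time_val (t : time R) : clock (time_val t) = t.
Proof.
apply/val_inj; rewrite /= /time_val; apply: max_r; exact: (ge0 t).
Qed.

Lemma clock_lip (x y : R) :
  `|time_val (clock x) - time_val (clock y)| <= `|x - y|.
Proof.
rewrite !time_val_clock.
have h1 : x - y <= `|x - y| := ler_norm _.
have h2 : y - x <= `|x - y| by rewrite distrC ler_norm.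
have h3 : 0 <= `|x - y| by [].
rewrite ler_norml; move: `|x - y| h1 h2 h3 => N h1 h2 h3.
by case: (lerP 0 x) => ?; case: (lerP 0 y) => ?; apply/andP; split; lra.
Qed.

Lemma patrol_clock_lip (S : patrol Q) (x y : R) :
  mdist (S (clock x)) (S (clock y)) <= `|x - y|.
Proof. exact: le_trans (unit_speed _ _ _) (clock_lip _ _). Qed.

Variable alpha : {posnum R}.

(** Interception up to an error [n.+1%:R^-1] in time and in space, witnessed by a rational time and
    a rational abscissa on some arc, so that only countable unions and intersections occur. *)
Let near_hit (n : nat) (q : rat) (p : arc Q * rat) : set (patrol Q * attack Q) :=
  [set z : patrol Q * attack Q |
    mdist (along p.1 (ratr p.2)) (z.1 (clock (ratr q))) < n.+1%:R^-1] `&`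
  [set z : patrol Q * attack Q |
    mdist (along p.1 (ratr p.2)) z.2.1 < n.+1%:R^-1] `&`
  [set z : patrol Q * attack Q |
    (time_val z.2.2 < ratr q + n.+1%:R^-1) /\
    (ratr q < time_val z.2.2 + alpha%:num + n.+1%:R^-1)].

(* By compactness of the time window, a patrol that passes arbitrarily close to x
   during it visits x. *)
Let interceptsE : [set z : patrol Q * attack Q | intercepts alpha z.1 z.2] =
  \bigcap_n \bigcup_q \bigcup_p near_hit n q p.
Proof.
apply/seteqP; split => -[S [x tau]] /=.
  move=> [t /andP[t1 t2] Stx] n _; rewrite /= in Stx t1 t2.
  have e0 : 0 < (n.+1%:R^-1 : R) by rewrite invr_gt0.
  set e := n.+1%:R^-1 in e0.
  have [|q hq] := @dense_rat (time_val t) (e / 2); first by rewrite divr_gt0.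
  have [a [y ya xE]] := alongP x.
  have [|r hr] := @dense_rat y (e / 2); first by rewrite divr_gt0.
  exists q => //; exists (a, r) => //=.
  have d1 : mdist (along a (ratr r) : netpoint Q) x < e / 2.
    by rewrite xE; apply: le_lt_trans hr; exact: sp_dist_along.
  have d2 : mdist x (S (clock (ratr q))) < e / 2.
    rewrite -Stx -{1}(clock_time_val t) metric_sym.
    exact: le_lt_trans (patrol_clock_lip _ _ _) hq.
  split; [split|] => /=.
  - by have := metric_triangle (along a (ratr r)) x (S (clock (ratr q))); rewrite -/e; lra.
  - by rewrite -/e; lra.
  - rewrite -/e; move: hq; rewrite ltr_norml => /andP[h1 h2]; split; lra.
move=> H.
pose f (s : R) := mdist (S (clock s)) x.
have flip s s' : `|f s - f s'| <= `|s - s'|.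
  have h := patrol_clock_lip S s s'.
  have h1 := metric_triangle (S (clock s)) (S (clock s')) x.
  have h2 := metric_triangle (S (clock s')) (S (clock s)) x.
  rewrite (metric_sym (S (clock s')) (S (clock s))) in h2.
  rewrite /f ler_norml; apply/andP; split; lra.
have tau0 : 0 <= time_val tau by rewrite /time_val.
have a0 : 0 < alpha%:num by [].
have [||s] := @EVT_min R f (time_val tau) (time_val tau + alpha%:num).
- by rewrite lerDl ltW.
-  apply: continuous_subspaceT => y.
  apply/cvgrPdist_le => e e0; near=> z.
  apply: le_trans (flip _ _) _; near: z.
  exact: (@cvgr_dist_le _ _ _ (nbhs y) _ id y cvg_id).
rewrite in_itv/= => /andP[s1 s2] smin.
suff fs0 : f s = 0.
  exists (clock s); last exact: sp_dist_positivity.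
  by rewrite time_val_clock max_r; lra.
apply/eqP; rewrite eq_le mdist_ge0 andbT leNgt; apply/negP => fs.
(* Three errors of size [n.+1%:R^-1] arise below: one from moving the rational time into the window,
   two from passing through the rational point. *)
have [n hn] : exists n, n.+1%:R^-1 < f s / 3 :> R.
  have f3 : 0 < f s / 3 by rewrite divr_gt0.
  exists (Num.truncn (f s / 3)^-1); rewrite invf_plt ?posrE//.
  exact: truncnS_gt.
have [q _ [p _ [[h1 h2] [h3 h4]]]] := H n I; rewrite /= in h1 h2 h3 h4.
have e0 : 0 < (n.+1%:R^-1 : R) by rewrite invr_gt0.
set e := n.+1%:R^-1 in hn h1 h2 h3 h4 e0.
(* [s'] is the point of the time window nearest to the rational time. *)
have [s' [s'1 hs']] : exists s' : R,
    (time_val tau <= s' <= time_val tau + alpha%:num) /\ `|s' - ratr q| <= e.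
  have [qt|qt] := lerP (time_val tau) (ratr q).
    have [qta|qta] := lerP (ratr q) (time_val tau + alpha%:num).
      by exists (ratr q); rewrite qt qta subrr normr0 ltW.
    exists (time_val tau + alpha%:num); split; first by apply/andP; split; lra.
    by rewrite ler_norml; apply/andP; split; lra.
  exists (time_val tau); split; first by apply/andP; split; lra.
  by rewrite ler_norml; apply/andP; split; lra.
have k1 : f s <= f s' by apply: smin; rewrite in_itv.
have k2 := flip s' (ratr q).
have k3 : f (ratr q) <= e + e.
  have := metric_triangle (S (clock (ratr q))) (along p.1 (ratr p.2)) x.
  rewrite (metric_sym (S _) (along _ _)) /f; lra.
have k4 := ler_norm (f s' - f (ratr q)).
lra.
Unshelve. all: by end_near.
Qed.

Lemma measurable_intercepts :
  measurable [set z : patrol Q * attack Q | intercepts alpha z.1 z.2].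
Proof.
rewrite interceptsE; apply: bigcapT_measurable => n.
apply: bigcupT_measurable_rat => q.
apply: (@countable_bigcupT_measurable _ _ (arc Q * rat)%type); first exact: countableP.
move=> p; apply: measurableI; first apply: measurableI.
- rewrite -[X in measurable X]setTI.
  have mf : measurable_fun setT (fun z : patrol Q * attack Q => z.1 (clock (ratr q))).
    exact: (measurableT_comp (measurable_position _) measurable_fst).
  exact: (mf _ _ (measurable_ball_metric (along p.1 (ratr p.2)) _)).
- rewrite -[X in measurable X]setTI.
  have mf : measurable_fun setT (fun z : patrol Q * attack Q => z.2.1).
    exact: (measurableT_comp measurable_fst measurable_snd).
  exact: (mf _ _ (measurable_ball_metric (along p.1 (ratr p.2)) _)).
- have mf : measurable_fun setT (fun z : patrol Q * attack Q => time_val z.2.2).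
    apply: (measurableT_comp measurable_time_val).
    exact: (measurableT_comp measurable_snd measurable_snd).
  rewrite (_ : [set z | _] = setT `&` (fun z : patrol Q * attack Q => time_val z.2.2)
      @^-1` `]ratr q - alpha%:num - n.+1%:R^-1, ratr q + n.+1%:R^-1[).
    exact: mf.
  rewrite setTI; apply/seteqP; split => z /=; rewrite in_itv/=;
      move: (time_val z.2.2) (ratr q : R) (n.+1%:R^-1 : R) => t r e.
    by move=> [h1 h2]; apply/andP; split; lra.
  by move=> /andP[h1 h2]; split; lra.
Qed.

Lemma measurable_intercepted (S : patrol Q) :
  measurable [set x : attack Q | intercepts alpha S x].
Proof.
rewrite (_ : [set x | _] =
  xsection [set z : patrol Q * attack Q | intercepts alpha z.1 z.2] S).
  by apply: measurable_xsection; exact: measurable_intercepts.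
by apply/seteqP; split=> x /=; rewrite /xsection/= inE.
Qed.

Lemma measurable_intercepting (x : attack Q) :
  measurable [set S : patrol Q | intercepts alpha S x].
Proof.
rewrite (_ : [set S | _] =
  ysection [set z : patrol Q * attack Q | intercepts alpha z.1 z.2] x).
  by apply: measurable_ysection; exact: measurable_intercepts.
by apply/seteqP; split=> S /=; rewrite /ysection/= inE.
Qed.

Lemma payoff_le (P : probability (patrol Q) R) (A : probability (attack Q) R)
    (v : R) :
  (forall S, A [set x | intercepts alpha S x] <= v%:E)%E ->
  (payoff alpha P A <= v%:E)%E.
Proof.
move=> Av; apply: product_probability_le; first exact: measurable_intercepts.
move=> S; apply: le_trans (Av S); rewrite le_measure ?inE//.
- by apply: measurable_xsection; exact: measurable_intercepts.
- exact: measurable_intercepted.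
- by move=> x; rewrite /xsection/= inE.
Qed.

Lemma le_payoff (P : probability (patrol Q) R) (A : probability (attack Q) R)
    (v : R) : 0 <= v ->
  (forall x, v%:E <= P [set S | intercepts alpha S x])%E ->
  (v%:E <= payoff alpha P A)%E.
Proof.
move=> v0 Pv; apply: le_product_probability => //; first exact: measurable_intercepts.
move=> x; apply: le_trans (Pv x) _; rewrite le_measure ?inE//.
- exact: measurable_intercepting.
- by apply: measurable_ysection; exact: measurable_intercepts.
- by move=> S; rewrite /ysection/= inE.
Qed.

End Measurability.

(** * Length of the image of a patrol *)

Section DisjointSum.
Context d (T : measurableType d) (R : realType) (m : {measure set T -> \bar R}).
Variables (I : eqType) (F : I -> set T).
Hypothesis mF : forall i, measurable (F i).
Hypothesis disjF : forall i j, i != j -> F i `&` F j = set0.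

Lemma measure_disjoint_sum (s : seq I) : uniq s ->
  (\sum_(i <- s) m (F i))%E = m (\big[setU/set0]_(i <- s) F i).
Proof.
elim: s => [|i s IH] /=; first by rewrite !big_nil measure0.
move=> /andP[inotin us]; rewrite !big_cons IH// measureU//.
  by apply: bigsetU_measurable.
elim: s inotin {us IH} => [|j s IH]; first by rewrite big_nil setI0.
rewrite inE negb_or => /andP[ij /IH h].
by rewrite big_cons setIUr h setU0 disjF.
Qed.

Lemma measure_disjoint_sum_le (s : seq I) (X : set T) : uniq s ->
  measurable X -> (forall i, i \in s -> F i `<=` X) ->
  (\sum_(i <- s) m (F i) <= m X)%E.
Proof.
move=> us mX FX; rewrite measure_disjoint_sum// le_measure ?inE//.
  by apply: bigsetU_measurable.
elim: s FX {us} => [|i s IH] FX; first by rewrite big_nil.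
rewrite big_cons subUset; split; first by apply: FX; rewrite mem_head.
by apply: IH => j js; apply: FX; rewrite inE js orbT.
Qed.

End DisjointSum.

Lemma le_lambda (R : realType) (Q : network R) (A B : set (netpoint Q)) :
  A `<=` B -> (lambda A <= lambda B)%E.
Proof.
by move=> AB; apply: lee_sum => a _; apply: le_lebesgue_measure => x [? /AB].
Qed.

Section Tent.
Variables (R : realType) (Q : network R).
Implicit Types (a : arc Q) (c r x y : R) (p q : netpoint Q).

(** When [r] is at most the distance from [c] to either end of [a], this is a 1-Lipschitz function
    on the whole network that vanishes off [a]. *)
Definition tent a c r : netpoint Q -> R :=
  glue_fun (fun=> 0) (fun b x => if b == a then Num.max 0 (r - `|x - c|) else 0).

Section TentFacts.
Variables (a : arc Q) (c r : R).
Hypotheses (rc : r <= c) (rl : r <= len a - c).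

Lemma tentE b x : 0 <= x <= len b ->
  tent a c r (along b x) = if b == a then Num.max 0 (r - `|x - c|) else 0.
Proof.
move=> hx; rewrite /tent glue_funE//; case: eqP => // be; rewrite ?be.
  by rewrite max_l// sub0r normrN subr_le0 (le_trans rc)// ler_norm.
by rewrite max_l// subr_le0 (le_trans rl)// ler_norm.
Qed.

Lemma tent_lip p q : `|tent a c r p - tent a c r q| <= mdist p q.
Proof.
have H : forall b x y, 0 <= x <= len b -> 0 <= y <= len b ->
    tent a c r (along b x) - tent a c r (along b y) <= `|x - y|.
  move=> b x y hx hy; rewrite !tentE//; case: eqP => _; last by rewrite subrr.
  have h1 := ler_distD x y c; rewrite (distrC y x) in h1.
  have h2 : 0 <= `|x - y| by [].
  move: `|x - y| `|x - c| `|y - c| h1 h2 => N A B h1 h2.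
  by case: (lerP 0 (r - A)) => ?; case: (lerP 0 (r - B)) => ?; lra.
rewrite ler_norml; apply/andP; split; last exact: (sp_dist_lb H).
have := sp_dist_lb H q p; rewrite sp_dist_sym -[sp_dist p q]/(mdist p q); lra.
Qed.

End TentFacts.

Section LipschitzImage.
Variable S : R -> netpoint Q.
Hypothesis S_lip : forall s t, mdist (S s) (S t) <= `|s - t|.
Variables (J : set R) (C : set (netpoint Q)).
Hypotheses (mJ : measurable J) (mC : measurable C).
Local Notation leb := (@lebesgue_measure R).

(* The tent of half-width len e.1 / 4 around this point is positive exactly on
   the open half of the arc next to the start of e. *)
Definition quarter (e : darc Q) : R :=
  if e.2 then len e.1 / 4 else 3 * len e.1 / 4.

Let piece_times (e : darc Q) : set R :=
  J `&` S @^-1` C `&`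
  (fun t => tent e.1 (quarter e) (len e.1 / 4) (S t)) @^-1` `]0, +oo[%classic.

Let mS : measurable_fun setT S.
Proof. exact: measurable_lip. Qed.

Let mSC : measurable (J `&` S @^-1` C).
Proof. by apply: measurableI => //; rewrite -[X in measurable X]setTI; exact: mS. Qed.

Let quarter_bounds (e : darc Q) :
  len e.1 / 4 <= quarter e /\ len e.1 / 4 <= len e.1 - quarter e.
Proof. by have := len_gt0 e.1; rewrite /quarter; case: ifP => _; split; lra. Qed.

Let half_tentE (e : darc Q) b x : 0 <= x <= len b ->
  (0 < tent e.1 (quarter e) (len e.1 / 4) (along b x)) =
  (b == e.1) && (if e.2 then 0 < x < len b / 2 else len b / 2 < x < len b).
Proof.
move=> hx; have [h1 h2] := quarter_bounds e; rewrite tentE//.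
case: eqP => [be|_] /=; last by rewrite ltxx.
rewrite lt_max ltxx/= subr_gt0 ltr_distl /quarter -be.
by case: ifP => _; apply/andP/andP => -[]; split; lra.
Qed.

Let m_piece (e : darc Q) : measurable (piece_times e).
Proof.
apply: measurableI => //; rewrite -[X in measurable X]setTI.
have [h1 h2] := quarter_bounds e.
suff : measurable_fun setT (fun t => tent e.1 (quarter e) (len e.1 / 4) (S t)) by apply.
apply: continuous_measurable_fun => t; apply/cvgrPdist_le => u u0; near=> z.
apply: le_trans (tent_lip h1 h2 _ _) _; apply: le_trans (S_lip _ _) _; near: z.
exact: (@cvgr_dist_le _ _ _ (nbhs t) _ id t cvg_id).
Unshelve. all: by end_near.
Qed.

Let disj_piece (e e' : darc Q) : e != e' -> piece_times e `&` piece_times e' = set0.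
Proof.
move=> ee'; apply/seteqP; split => // t [[_ /= +] [_ /= +]].
rewrite !in_itv/= !andbT; have [a [x hx ->]] := alongP (S t).
rewrite !half_tentE// => /andP[/eqP e1 h] /andP[/eqP e2 h'].
case: e e' ee' e1 h e2 h' => [b i] [b' i'] /= + e1 + e2; subst b b'.
rewrite xpair_eqE eqxx/=; case: i; case: i' => // _ /andP[? ?] /andP[? ?]; lra.
Qed.

Let arc_image a :
  (arc_length a (C `&` S @` J) <=
   leb (piece_times (a, true)) + leb (piece_times (a, false)))%E.
Proof.
have la := len_gt0 a.
pose X (i : bool) : set R := along a @^-1` (C `&` S @` J) `&`
  [set x | if i then 0 < x < len a / 2 else len a / 2 < x < len a].
(* The tent with its peak at the middle of the arc is the distance to the nearer end. It gives the
   abscissa on the first half, and [len a] minus the abscissa on the second half. *)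
have XT i : (leb (X i) <= leb (piece_times (a, i)))%E.
  apply: (@lebesgue_measure_lip _ (fun t => if i
      then tent a (len a / 2) (len a / 2) (S t)
      else len a - tent a (len a / 2) (len a / 2) (S t))).
    move=> s t; apply: le_trans (S_lip s t).
    case: i; last (rewrite opprB addrCA (addrC (len a)) addrK distrC);
      by apply: tent_lip; lra.
  move=> x [[Cx [t Jt Stx]] hx].
  have xl : 0 <= x <= len a by case: (i) hx => /andP[? ?]; apply/andP; split; lra.
  exists t.
    split; first by split=> //=; rewrite Stx.
    by rewrite /= in_itv/= andbT Stx (@half_tentE (a, i))// eqxx.
  rewrite Stx !tentE ?eqxx; try lra.
  case: i hx => /andP[? ?].
    by rewrite ler0_norm ?max_r; lra.
  by rewrite ger0_norm ?max_r; lra.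
rewrite /arc_length.
(* The midpoint belongs to neither open half, but it is a null set. *)
apply: (@le_trans _ _ (leb (X true `|` X false `|` [set len a / 2]))).
  apply: le_lebesgue_measure => x [/=]; rewrite in_itv/= => /andP[x0 xl] h.
  case: (ltgtP x (len a / 2)) => xl2.
  - by left; left; split=> //; apply/andP.
  - by left; right; split=> //; apply/andP.
  - by right.
apply: le_trans (outer_measureU2 (mu_ext (@wlength R idfun)) _ _) _.
rewrite -[X in (_ + X)%E]/(leb [set len a / 2]) lebesgue_measure_set1 adde0.
apply: le_trans (outer_measureU2 (mu_ext (@wlength R idfun)) _ _) _.
exact: leeD (XT true) (XT false).
Qed.

(* On half an arc, the distance to the nearer end is the restriction of a
   1-Lipschitz function on the network, which reduces the claim to real
   functions although an arc need not be isometric to an interval. *)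
Lemma lambda_lip_image :
  (lambda (C `&` S @` J) <= leb (J `&` S @^-1` C))%E.
Proof.
rewrite /lambda.
apply: (@le_trans _ _ (\sum_(e : darc Q) leb (piece_times e))%E).
  apply: le_trans (lee_sum _ (fun a _ => arc_image a)) _.
  rewrite (eq_bigr (fun a => \sum_(i : bool) leb (piece_times (a, i)))%E).
    by rewrite pair_bigA /=; apply: lee_sum => -[].
  by move=> a _; rewrite big_bool.
have := @measure_disjoint_sum_le _ _ R leb _ _ m_piece disj_piece (index_enum _) (J `&` S @^-1` C).
apply => //.
  exact: index_enum_uniq.
by move=> e _ t [].
Qed.

End LipschitzImage.

End Tent.

(** * Leaf arcs *)

Section Graph.
Variables (R : realType) (Q : network R).
Implicit Types (u v : node Q) (a b : arc Q) (e f : darc Q).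

Definition flip e : darc Q := (e.1, ~~ e.2).

Lemma flipK : involutive flip.
Proof. by case=> a i; rewrite /flip/= negbK. Qed.

Lemma dstart_flip e : dstart (flip e) = dend e.
Proof. by case: e => a []. Qed.

Lemma dend_flip e : dend (flip e) = dstart e.
Proof. by case: e => a []. Qed.

Lemma flip_neq e : flip e != e.
Proof. by case: e => a []; rewrite /flip xpair_eqE eqxx. Qed.

Lemma same_arc e f : f.1 = e.1 -> f = e \/ f = flip e.
Proof.
by case: e f => a i [b j] /= ->; case: i; case: j; rewrite /flip/=; auto.
Qed.

Lemma reversalE e f : reversal e f = (f == flip e).
Proof.
case: e f => a i [b j]; rewrite /reversal /flip xpair_eqE/=.
by case: i; case: j.
Qed.

(** Connectedness in the form of an induction principle on nodes. *)
Lemma closed_nodes (N : pred (node Q)) u :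
  (forall a, N (src a) = N (dst a)) -> N u -> forall v, N v.
Proof.
move=> cN Nu v; suff : (u \in N) = (v \in N) by rewrite !unfold_in Nu => <-.
apply: closed_connect (net_connected u v) => x y /existsP[a].
by case/orP => /andP[/eqP<- /eqP<-]; rewrite !unfold_in cN.
Qed.

Lemma dart_at v : exists e, dstart e = v.
Proof.
apply: contrapT => H.
suff /(_ (src (enum_val (Ordinal (has_arc Q))))) : forall w, w == v.
  by move=> /eqP h; apply: H; exists (enum_val (Ordinal (has_arc Q)), true).
apply: (@closed_nodes (pred1 v)) => //= a.
apply/eqP/eqP => h; case: H.
  by exists (a, true).
by exists (a, false).
Qed.

(** A loop gives two darts starting at its node, in agreement with its double count in the
    degree. *)
Lemma degreeE v : degree v = #|[set e : darc Q | dstart e == v]%SET|.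
Proof.
rewrite /degree -!sum1_card.
rewrite [RHS](eq_bigl (fun e : darc Q => dstart e == v)); last by move=> e; rewrite inE.
rewrite [RHS]big_mkcond/= (eq_bigr (fun e : arc Q * bool =>
   (fun a i => (if (if i then src a else dst a) == v then 1 else 0)%N) e.1 e.2))//.
rewrite -(pair_bigA _ (fun a i => (if (if i then src a else dst a) == v then 1 else 0)%N)) /=.
rewrite [RHS](eq_bigr (fun a => (if src a == v then 1 else 0) + (if dst a == v then 1 else 0))%N).
  rewrite big_split/=; congr (_ + _)%N.
    by rewrite [LHS]big_mkcond; apply: eq_bigr => a _; rewrite inE.
  by rewrite [LHS]big_mkcond; apply: eq_bigr => a _; rewrite inE.
by move=> a _; rewrite big_bool.
Qed.

Lemma degree_gt0 v : (0 < degree v)%N.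
Proof.
have [e ev] := dart_at v.
by rewrite degreeE card_gt0; apply/set0Pn; exists e; rewrite inE ev.
Qed.

Lemma leaf_dart e f : leaf (dstart e) -> dstart f = dstart e -> f = e.
Proof.
rewrite /leaf degreeE => /cards1P[g hg] fe.
have : e \in [set g]%SET by rewrite -hg inE.
have : f \in [set g]%SET by rewrite -hg inE fe.
by rewrite !inE => /eqP-> /eqP->.
Qed.

(** If the arc of [e] were a loop, [e] and [flip e] would be two darts starting at a leaf. *)
Lemma leaf_dend_neq e : leaf (dstart e) -> dend e != dstart e.
Proof.
move=> le; apply/eqP => h; have := flip_neq e.
by rewrite (leaf_dart le (etrans (dstart_flip e) h)) eqxx.
Qed.

(* Otherwise e would be the only arc and the network a line segment. *)
Lemma leaf_dend e : leaf (dstart e) -> ~~ leaf (dend e).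
Proof.
move=> l1; apply/negP => l2; have neq := leaf_dend_neq l1.
pose N := [pred w | (w == dstart e) || (w == dend e)].
have dart_in f : N (dstart f) -> f.1 = e.1.
  case/orP => /eqP h; first by rewrite (leaf_dart l1 h).
  by rewrite -(dstart_flip e) in l2 h; rewrite (leaf_dart l2 h).
have Nd f : N (dstart f) -> N (dend f).
  move=> Nf; have [->|->] := same_arc (dart_in _ Nf) => /=.
    by rewrite eqxx orbT.
  by rewrite dend_flip eqxx.
have cN a : N (src a) = N (dst a).
  by apply/idP/idP; [exact: (Nd (a, true))|exact: (Nd (a, false))].
have allN : forall v, N v by apply: (closed_nodes cN (u := dstart e)); rewrite /= eqxx.
have := not_segment Q; rewrite negb_and => /orP[]/negP; apply; apply/eqP.
  rewrite -(card1 e.1); apply: eq_card => b; rewrite !inE.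
  by apply/esym/eqP; apply: (dart_in (b, true)); exact: allN.
rewrite (_ : 2%N = #|[set dstart e; dend e]%SET|); last by rewrite cards2 eq_sym neq.
by rewrite -cardsT; apply: eq_card => v; rewrite !inE; apply/esym; exact: allN.
Qed.

Lemma leaf_arc_dart e : leaf_arc e.1 = leaf (dstart e) || leaf (dend e).
Proof. by case: e => a []; rewrite /leaf_arc//= orbC. Qed.

Lemma along_inr a x : 0 < x < len a -> exists i, along a x = inr i.
Proof.
move=> hx; rewrite /along; case: insubP => [i _ _|]; first by exists i.
by rewrite /= hx.
Qed.

End Graph.

Section LeafDistance.
Variables (R : realType) (Q : network R) (e : darc Q).
Hypothesis leaf_e : leaf (dstart e).

(* Distance from the leaf node at which e starts: a point off the leaf arc is
   reached through the other end of that arc. *)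
Definition leaf_depth : netpoint Q -> R :=
  glue_fun
    (fun v => if v == dstart e then 0
              else len e.1 + mdist (npoint (dend e) : netpoint Q) (npoint v))
    (fun b x => if b == e.1 then (if e.2 then x else len b - x)
                else len e.1 + mdist (npoint (dend e) : netpoint Q) (along b x)).

Lemma leaf_depthE b x : 0 <= x <= len b -> leaf_depth (along b x) =
  if b == e.1 then (if e.2 then x else len b - x)
  else len e.1 + mdist (npoint (dend e) : netpoint Q) (along b x).
Proof.
have neq := leaf_dend_neq leaf_e.
move=> hx; rewrite /leaf_depth glue_funE//.
  case: eqP => [->|be].
    case: e neq => a [] neq /=; first by rewrite /dstart/= eqxx.
    by rewrite /dstart /dend/= -/(dend (a, false)) (negPf neq) mdistxx addr0 subr0.
  case: eqP => h; last by rewrite along0.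
  by have := leaf_dart (f := (b, true)) leaf_e h => ebt; case: be; rewrite -ebt.
case: eqP => [->|be].
  case: e neq => a [] neq /=; last by rewrite /dstart/= eqxx subrr.
  by rewrite /dstart /dend/= -/(dend (a, false)) (negPf neq) mdistxx addr0.
case: eqP => h; last by rewrite along_len.
by have := leaf_dart (f := (b, false)) leaf_e h => ebt; case: be; rewrite -ebt.
Qed.

(** [leaf_depth] vanishes at the leaf and is 1-Lipschitz along every arc, so [sp_dist_lb]
    applies. *)
Lemma leaf_depth_le p : leaf_depth p <= mdist (npoint (dstart e) : netpoint Q) p.
Proof.
have H : forall b x y, 0 <= x <= len b -> 0 <= y <= len b ->
    leaf_depth (along b x) - leaf_depth (along b y) <= `|x - y|.
  move=> b x y hx hy; rewrite !leaf_depthE//; case: eqP => _.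
    case: (e.2); first exact: ler_norm.
    by have := ler_norm (y - x); rewrite distrC; move: `|x - y| => N; lra.
  rewrite opprD addrACA subrr add0r lerBlDr.
  apply: le_trans (metric_triangle _ (along b y) _) _.
  rewrite addrC lerD2r metric_sym; exact: sp_dist_along.
have := sp_dist_lb H p (npoint (dstart e)).
by rewrite {2}/leaf_depth/= eqxx subr0 sp_dist_sym.
Qed.

Lemma leaf_depth_node v : v != dstart e ->
  leaf_depth (npoint v) = len e.1 + mdist (npoint (dend e) : netpoint Q) (npoint v).
Proof. by move=> h; rewrite /leaf_depth/= (negPf h). Qed.

(** On the leaf arc the ball lies in an interval of length [r]. Off this arc the depth is [len e.1]
    plus the distance to the inner end, so the ball contains no interior point of another arc. *)
Lemma lambda_leaf_ball (r : R) : 0 <= r <= len e.1 ->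
  (lambda [set q | (mdist (npoint (dstart e) : netpoint Q) q <= r)%R] <= r%:E)%E.
Proof.
move=> /andP[r0 rl]; rewrite /lambda (bigD1 e.1)//= big1 ?adde0.
  apply: (@le_trans _ _ (lebesgue_measure (if e.2 then `[0, r]%classic
                                   else `[len e.1 - r, len e.1]%classic))).
    apply: le_lebesgue_measure => x [/=]; rewrite in_itv/= => /andP[x0 xl].
    move=> /(le_trans (leaf_depth_le _)).
    rewrite leaf_depthE ?eqxx ?(ltW x0) ?(ltW xl)//.
    by case: ifP => _ h; rewrite /= in_itv/=; apply/andP; split; lra.
  by case: ifP => _; rewrite lebesgue_measure_itv/= lte_fin; case: ifP => _;
    rewrite -?EFinD lee_fin; lra.
move=> b be; rewrite /arc_length (_ : _ `&` _ = set0) ?measure0//.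
apply/seteqP; split=> // x [/=]; rewrite in_itv/= => hx.
have [i ai] := along_inr hx; case/andP: (hx) => x0 xl.
move=> /(le_trans (leaf_depth_le _)).
rewrite leaf_depthE ?(negPf be) ?(ltW x0) ?(ltW xl)// => h.
have : mdist (npoint (dend e) : netpoint Q) (along b x) = 0.
  by apply/eqP; rewrite eq_le mdist_ge0 andbT; lra.
by move/mdist_positivity; rewrite ai.
Qed.

End LeafDistance.

Section LeafNodes.
Variables (R : realType) (Q : network R) (alpha : {posnum R}).
Hypothesis leaf_arc_len : forall a : arc Q, leaf_arc a -> alpha%:num <= 2 * len a.

Lemma half_le_leaf_arc e : leaf (dstart e) -> alpha%:num / 2 <= len (e : darc Q).1.
Proof.
by move=> le; have := leaf_arc_len (a := e.1); rewrite leaf_arc_dart le => /(_ isT); lra.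
Qed.

(** A path between two leaves runs through both leaf arcs, each of length at least half of [alpha].
    The depth from [u] accounts for the first arc, and the depth from [v], taken at the inner end of
    the first arc, for the second. *)
Lemma leaf_dist (u v : node Q) : leaf u -> leaf v -> u != v ->
  alpha%:num <= mdist (npoint u : netpoint Q) (npoint v).
Proof.
have [e <-] := dart_at u; have [f <-] := dart_at v => lu lv uv.
have h1 := leaf_depth_le lu (npoint (dstart f)).
rewrite leaf_depth_node 1?eq_sym// in h1.
have h2 := leaf_depth_le lv (npoint (dend e)).
rewrite leaf_depth_node in h2; last first.
  by apply/eqP => h; have := leaf_dend lu; rewrite h lv.
have h3 := mdist_ge0 (npoint (dend f) : netpoint Q) (npoint (dend e)).
rewrite (metric_sym (npoint (dstart f) : netpoint Q)) in h2.
have := half_le_leaf_arc lu; have := half_le_leaf_arc lv; lra.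
Qed.

Lemma mem_leaf_nodes (x : netpoint Q) :
  x \in leaf_nodes Q -> exists2 v, leaf v & x = npoint v.
Proof. by move=> /imfsetP[v /=]; rewrite inE => lv ->; exists v. Qed.

Lemma card_leaf_nodes : #|` leaf_nodes Q| = #|[set v : node Q | leaf v]%SET|.
Proof.
rewrite /leaf_nodes card_imfset/=; last by move=> u v [].
by rewrite cardE.
Qed.

Lemma independent_leaf_nodes : independent alpha (leaf_nodes Q).
Proof.
move=> _ _ /mem_leaf_nodes[u lu ->] /mem_leaf_nodes[v lv ->] uv.
by apply: leaf_dist => //; apply: contraNN uv => /eqP->.
Qed.

Lemma lambda_near_leaf_nodes : (lambda (near_set alpha (leaf_nodes Q)) <=
  (#|[set v : node Q | leaf v]%SET|%:R * (alpha%:num / 2))%:E)%E.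
Proof.
pose B (x : netpoint Q) := [set q | mdist x q <= alpha%:num / 2].
have mB x : measurable (B x).
  rewrite (_ : B x = near_set alpha [fset x]%fset); first exact: measurable_near_set.
  apply/seteqP; split=> q /=; first by exists x; rewrite ?inE.
  by move=> [y]; rewrite inE => /eqP->.
rewrite -card_leaf_nodes.
have -> : near_set alpha (leaf_nodes Q) = \big[setU/set0]_(x <- leaf_nodes Q) B x.
  rewrite -bigcup_seq; apply/seteqP; split=> q /=.
    by move=> [x xI xq]; exists x.
  by move=> [x xI xq]; exists x.
have : forall x, x \in enum_fset (leaf_nodes Q) -> (lambda (B x) <= (alpha%:num / 2)%:E)%E.
  move=> _ /mem_leaf_nodes[v lv ->]; have [e ev] := dart_at v; rewrite -ev in lv *.
  by apply: (lambda_leaf_ball lv); rewrite divr_ge0//= half_le_leaf_arc.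
elim: (enum_fset (leaf_nodes Q)) => [|x s IH] H.
  by rewrite big_nil measure0 mul0r.
rewrite big_cons /= -natr1 mulrDl mul1r addrC EFinD.
apply: le_trans (measureU2 _ _ _) _ => //; first exact: bigsetU_measurable.
apply: leeD; first by apply: H; rewrite mem_head.
by apply: IH => y ys; apply: H; rewrite inE ys orbT.
Qed.

End LeafNodes.

(** * The attacker *)

Lemma uniform_probE (R : realType) (a b : R) (ab : a < b) (U : set R) :
  measurable U ->
  uniform_prob ab U = ((b - a)^-1%:E * lebesgue_measure (U `&` `[a, b]))%E.
Proof.
move=> mU; rewrite /uniform_prob integral_uniform_pdf.
rewrite (eq_integral (cst (b - a)^-1%:E)).
  by rewrite integral_cst//; exact: measurableI.
move=> x; rewrite inE => -[_ /=]; rewrite in_itv/= => xab.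
by rewrite /uniform_pdf xab.
Qed.

Section AttackerBound.
Variables (R : realType) (Q : network R) (alpha : {posnum R}).
Hypothesis leaf_arc_len : forall a : arc Q, leaf_arc a -> alpha%:num <= 2 * len a.
Variable S : patrol Q.
Local Notation al := (alpha%:num).
Local Notation leb := (@lebesgue_measure R).
Local Notation I := (leaf_nodes Q).
Local Notation W := (near_set alpha I).
Local Notation hits := [set x | intercepts alpha S x].

Let f (t : R) : netpoint Q := S (clock t).

Let f_lip s t : mdist (f s) (f t) <= `|s - t|.
Proof. exact: patrol_clock_lip. Qed.

Let al_gt0 : 0 < al. Proof. by []. Qed.

(** These are the start times at which an attack at [x] is intercepted, not the times at which the
    patrol is at [x]. *)
Let visits (x : netpoint Q) : set R := [set t | hits (x, clock t)].

Let visitsP x (t : R) : 0 <= t -> visits x t ->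
  exists2 s, t <= s <= t + al & f s = x.
Proof.
move=> t0 [s hs Ssx]; rewrite (_ : time_val _ = t) in hs; last exact: max_r.
by exists (time_val s) => //; rewrite /f clock_time_val.
Qed.

Let m_visits x : measurable (visits x).
Proof.
rewrite -[X in measurable X]setTI.
have m2 : measurable_fun setT (fun t : R => (x, clock t) : attack Q).
  by apply: measurable_fun_pair => //; exact: measurable_clock.
exact: (m2 measurableT _ (measurable_intercepted alpha S)).
Qed.

Let leaf_far x y s t : x \in I -> y \in I -> f s = x -> f t = y ->
  `|s - t| < al -> x = y.
Proof.
move=> xI yI fs ft st; apply/eqP/negPn/negP => xy.
have := independent_leaf_nodes leaf_arc_len xI yI xy.
by rewrite leNgt -fs -ft (le_lt_trans (f_lip _ _) st).
Qed.

(* Leaf nodes are at distance at least alpha, so a time window of length alpha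
   contains visits to two of them only when it starts at one and ends at the
   other. *)
Let double (t : R) := exists x y, [/\ x \in I, y \in I, x != y, f t = x & f (t + al) = y].

Let two_visits x y (t : R) : 0 <= t -> x \in I -> y \in I -> x != y ->
  visits x t -> visits y t -> double t.
Proof.
move=> t0 xI yI xy /(visitsP t0)[s /andP[s1 s2] fs] /(visitsP t0)[s' /andP[s'1 s'2] fs'].
have : al <= `|s - s'|.
  by rewrite leNgt; apply: contraNN xy => h; apply/eqP; exact: leaf_far fs fs' h.
have [ss|ss] := lerP s' s => h.
  have e1 : s' = t by lra.
  have e2 : s = t + al by lra.
  by exists y, x; rewrite eq_sym xy xI yI -fs -fs' e1 e2.
have e1 : s = t by lra.
have e2 : s' = t + al by lra.
by exists x, y; rewrite xy xI yI -fs -fs' e1 e2.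
Qed.

(** If [s < t], the times [s] and [t], and also [t] and [s + al], are less than [al] apart, so the
    leaves visited at these three times coincide. This contradicts that those at [s] and [s + al]
    differ. *)
Let double_inj (s t : R) : 0 < s < al -> 0 < t < al -> double s -> double t -> s = t.
Proof.
wlog st : s t / s < t => [H|].
  case: (ltgtP s t) => // h hs ht ds dt; first exact: H.
  by apply/esym; exact: H.
move=> /andP[s0 sa] /andP[t0 ta] [x [y [xI yI xy fs fsa]]] [z [_ [zI _ _ ft _]]].
have xz : x = z by apply: leaf_far fs ft _ => //; rewrite ltr0_norm; lra.
have zy : z = y by apply: leaf_far ft fsa _ => //; rewrite ltr0_norm; lra.
by rewrite xz zy eqxx in xy.
Qed.

Let exceptional : exists n : R, forall t : R, 0 < t < al -> double t -> t = n.
Proof.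
case: (pselect (exists2 n, 0 < n < al & double n)) => [[n hn dn]|H].
  by exists n => t ht dt; exact: double_inj.
by exists 0 => t ht dt; case: H; exists t.
Qed.

(** The shift by [al / 2] is due to the start time of the far attacks, which are intercepted between
    [al / 2] and [al / 2 + al]. It also separates these times from the visits: a patrol that meets a
    leaf between [t] and [t + al] is near that leaf at [t + al / 2]. *)
Let far_times : set R := `[0, al] `&` [set t | (~` W) (f (t + al / 2))].

Let mW : measurable W. Proof. exact: measurable_near_set. Qed.

Let m_far_times : measurable far_times.
Proof.
apply: measurableI => //; rewrite -[X in measurable X]setTI.
have mf : measurable_fun setT (fun t : R => f (t + al / 2)).
  apply: measurable_lip => s t; apply: le_trans (f_lip _ _) _.
  by rewrite opprD addrACA subrr addr0.
by apply: (mf measurableT _ (measurableC mW)).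
Qed.

Let visits_near x (t : R) : x \in I -> 0 <= t -> visits x t -> W (f (t + al / 2)).
Proof.
move=> xI t0 /(visitsP t0)[s /andP[s1 s2] fs]; exists x => //.
by rewrite -fs; apply: le_trans (f_lip _ _) _; rewrite ler_norml; apply/andP; split; lra.
Qed.

Lemma sum_visits : (\sum_(x <- I) leb (visits x `&` `[0%R, al])
  + attack_far alpha I hits <= al%:E)%E.
Proof.
have [n hn] := exceptional.
(* Removing the ends of the interval and the exceptional time makes these sets disjoint for distinct
   leaves, at the cost of a null set. *)
pose A x : set R := visits x `&` `]0, al[ `\` [set n].
have far : (attack_far alpha I hits <= leb far_times)%E.
  apply: (@le_trans _ _ (lambda (~` W `&` f @` `[al / 2, al / 2 + al]))).
    apply: le_lambda => x [/= hx Wx]; split=> //.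
    by have [|s hs fs] := visitsP _ hx; [|exists s => //=; rewrite in_itv].
  apply: le_trans (lambda_lip_image f_lip _ (measurableC mW)) _ => //.
  apply: (@lebesgue_measure_shift _ (- (al / 2))) => x [/=].
  rewrite !in_itv/= => /andP[h1 h2] hx; split; last by rewrite /= subrK.
  by rewrite /= in_itv/=; apply/andP; split; lra.
have AE x : (leb (visits x `&` `[0%R, al]) <= leb (A x))%E.
  apply: (@le_trans _ _ (leb (A x `|` ([set n] `|` ([set 0%R] `|` [set al]))))).
    apply: le_lebesgue_measure => t [vt /=]; rewrite in_itv/= => /andP[t0 ta].
    have [->|tn] := eqVneq t n; first by right; left.
    have [->|t00] := eqVneq t 0; first by right; right; left.
    have [->|taa] := eqVneq t al; first by right; right; right.
    left; split; last by move=> /= h; rewrite h eqxx in tn.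
    split=> //; rewrite /= in_itv/= !lt_neqAle t0 ta taa eq_sym t00.
    by [].
  apply: le_trans (outer_measureU2 (mu_ext (@wlength R idfun)) _ _) _.
  rewrite -[leRHS]adde0; apply: leeD => //.
  have U := outer_measureU2 (mu_ext (@wlength R idfun)).
  apply: le_trans (U _ _) _; rewrite -[X in (X + _)%E]/(leb [set n]) lebesgue_measure_set1 add0e.
  apply: le_trans (U _ _) _; rewrite -[X in (X + _)%E]/(leb [set 0%R]) lebesgue_measure_set1 add0e.
  by rewrite -[X in (X <= _)%E]/(leb [set al]) lebesgue_measure_set1.
have mA x : measurable (A x) by apply: measurableD => //; exact: measurableI.
(* [None] indexes the far region. Points that are not leaves receive the empty set, so that
   disjointness holds for all pairs of indices. *)
pose F (o : option (netpoint Q)) : set R :=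
  if o is Some x then (if x \in I then A x else set0) else far_times.
have mF o : measurable (F o) by case: o => [x|] //=; case: ifP.
have dF o o' : o != o' -> F o `&` F o' = set0.
  have dAfar x : x \in I -> A x `&` far_times = set0.
    move=> xI; apply/seteqP; split=> // t [[[vt +] _] [_ /=]].
    by rewrite /= in_itv/= => /andP[/ltW t0 _]; apply; exact: visits_near vt.
  case: o o' => [x|] [y|] //=; last first.
  - by case: ifP => yI _; rewrite setIC ?dAfar// set0I.
  - by case: ifP => xI _; rewrite ?dAfar// set0I.
  move=> xy; case: ifP => xI; last by rewrite set0I.
  case: ifP => yI; last by rewrite setI0.
  apply/seteqP; split=> // t [[[vx +] tn] [[vy _] _]].
  rewrite /= in_itv/= => ht; apply: tn; apply: hn => //.
  by case/andP: ht => /ltW t0 _; apply: two_visits vx vy.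
have lebI : leb `[0%R, al] = al%:E.
  by rewrite lebesgue_measure_itv/= lte_fin al_gt0 sube0.
have := @measure_disjoint_sum_le _ _ R leb _ _ mF dF (None :: map Some I) `[0%R, al].
rewrite big_cons big_map [X in (_ <= X)%E]lebI => H.
rewrite addeC; apply: (@le_trans _ _ (leb far_times + \sum_(x <- I) leb (F (Some x)))%E).
  apply: leeD => //; rewrite big_seq [leRHS]big_seq; apply: lee_sum => x xI.
  by rewrite /= xI.
apply: H => //.
  rewrite /= map_inj_uniq ?fset_uniq ?andbT; last by move=> x y [].
  by apply/negP => /mapP[].
move=> [x|] _ /=; last by move=> t [].
case: ifP => _ t; last by move=> [].
move=> [[_ /= ht] _]; move: ht; rewrite !in_itv/= => /andP[t0 ta]; by rewrite !ltW.
Qed.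
Lemma far_length_ge :
  mu Q - #|[set v : node Q | leaf v]%SET|%:R * (al / 2) <= far_length alpha I.
Proof.
have lT : lambda [set: netpoint Q] = (lambda W + lambda (~` W))%E.
  rewrite -measureU ?setvU ?setICr//; first by rewrite setUv.
  exact: measurableC.
rewrite /mu /far_length lT fineD ?lambda_fin//; last exact: measurableC.
have : fine (lambda W) <= #|[set v : node Q | leaf v]%SET|%:R * (al / 2).
  rewrite -lee_fin fineK ?lambda_fin//.
  exact: lambda_near_leaf_nodes.
lra.
Qed.

Lemma independent_attack_le : (independent_attack alpha I hits <=
  (al / (mu Q + #|[set v : node Q | leaf v]%SET|%:R * al / 2))%:E)%E.
Proof.
have farge := far_length_ge.
have mu0 : 0 < mu Q by apply: fine_gt0; rewrite lambdaT_gt0 lambdaT ltry.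
have far0 : 0 <= far_length alpha I by exact/fine_ge0/measure_ge0.
rewrite /independent_attack /point_prob card_leaf_nodes.
set l : R := #|_|%:R in farge *; set m := far_length _ _ in farge far0 *.
have l0 : 0 <= l by exact: ler0n.
have la0 : 0 <= l * al by rewrite mulr_ge0.
have M0 : 0 < m + l * al.
  by move: farge la0; rewrite mulrA; move: (l * al) => la; lra.
(* Once the density [al^-1] of the start time is included, both weights of the attack equal [c],
   except that division by zero makes the first one 0 when [l = 0] and the second one 0 when
   [m = 0]. *)
pose c := (m + l * al)^-1.
have c0 : 0 < c by rewrite invr_gt0.
have sum_ge0 : (0 <= \sum_(x <- I) leb (visits x `&` `[0%R, al]))%E.
  by apply: sume_ge0 => x _; exact: measure_ge0.
have h1 : ((l * al / (m + l * al) / l)%:E * \sum_(x <- I) attack_at alpha x hits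
    <= c%:E * \sum_(x <- I) leb (visits x `&` `[0%R, al]))%E.
  rewrite (eq_bigr (fun x => (al^-1)%:E * leb (visits x `&` `[0%R, al]))%E); last first.
    by move=> x _; rewrite /attack_at uniform_probE ?subr0//; exact: m_visits.
  rewrite -ge0_sume_distrr//.
  rewrite muleA -EFinM; apply: lee_wpmul2r => //; rewrite lee_fin.
  have [->|ln0] := eqVneq l 0; first by rewrite !mul0r ltW.
  by rewrite le_eqVlt /c; apply/orP; left; apply/eqP; field; rewrite ln0 !gt_eqF.
have h2 : (((1 - l * al / (m + l * al)) / m)%:E * attack_far alpha I hits
    <= c%:E * attack_far alpha I hits)%E.
  apply: lee_wpmul2r; first exact: measure_ge0.
  rewrite lee_fin.
  have [->|mn0] := eqVneq m 0; first by rewrite invr0 mulr0 ltW.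
  by rewrite le_eqVlt /c; apply/orP; left; apply/eqP; field; rewrite mn0 gt_eqF.
apply: le_trans (leeD h1 h2) _.
rewrite -ge0_muleDr//.
apply: le_trans (lee_wpmul2l _ sum_visits) _; first by rewrite lee_fin ltW.
(* By [farge], the denominator [m + l * al] is at least [mu Q + l * al / 2]. *)
rewrite -EFinM lee_fin mulrC ler_wpM2l// lef_pV2 ?posrE//.
  by move: farge; rewrite mulrA; move: (l * al) => la; lra.
by rewrite ltr_wpDr// divr_ge0.
Qed.

End AttackerBound.

(** * Existence of a double tour *)

Section Tours.
Variables (R : realType) (Q : network R).
Implicit Types (e f : darc Q) (w : seq (darc Q)) (ws : seq (seq (darc Q))).

Lemma map_dend w : cycle (@consecutive R Q) w ->
  map (@dend R Q) w = rot 1 (map (@dstart R Q) w).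
Proof.
case: w => // e w /=; rewrite rot1_cons.
elim: w e {2 4}e => [|f w IH] e e0 /=; first by rewrite andbT => /eqP->.
by move=> /andP[/eqP-> /IH->].
Qed.

Lemma dend_in w e : cycle (@consecutive R Q) w -> e \in w ->
  exists2 f, f \in w & dstart f = dend e.
Proof.
move=> cw ew; have : dend e \in map (@dend R Q) w by apply: map_f.
by rewrite map_dend// mem_rot => /mapP[f fw ->]; exists f.
Qed.

(** A turn is allowed only at the leaf itself, while [double_tour] allows it at either end of a leaf
    arc. This condition on the node is what face tracing gives and what splicing preserves. *)
Definition good_step e f := consecutive e f && (reversal e f ==> leaf (dend e)).

Lemma good_step_flip e f : good_step (flip f) (flip e) = good_step e f.
Proof.
rewrite /good_step !reversalE flipK /consecutive dend_flip dstart_flip eq_sym.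
case: eqP => //= h; rewrite h; congr (_ ==> _).
by apply/eqP/eqP => [<-|->]; rewrite ?flipK.
Qed.

Definition rev_walk w := rev (map (@flip R Q) w).

Lemma cycle_rev_walk w : cycle good_step (rev_walk w) = cycle good_step w.
Proof.
rewrite /rev_walk rev_cycle cycle_map; apply: eq_cycle => e f /=.
exact: good_step_flip.
Qed.

(** Splicing in a reversed walk involves only its first and last darts. *)
Lemma rev_walk_cons e w : exists2 q,
  rev_walk (e :: w) = flip (last e w) :: q & last (flip (last e w)) q = flip e.
Proof.
exists (rev (map (@flip R Q) (belast e w))).
  by rewrite /rev_walk lastI map_rcons rev_rcons.
rewrite -[LHS]/(last (flip e) (flip (last e w) :: _)) -rev_rcons -map_rcons -lastI.
by rewrite /= rev_cons last_rcons.
Qed.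

Lemma count_rev_walk a w :
  count (fun e : darc Q => e.1 == a) (rev_walk w) =
  count (fun e : darc Q => e.1 == a) w.
Proof. by rewrite /rev_walk count_rev count_map; apply: eq_count. Qed.

Lemma cat_good e f (p q : seq (darc Q)) :
  cycle good_step (e :: p) -> cycle good_step (f :: q) ->
  good_step (last e p) f -> good_step (last f q) e ->
  cycle good_step ((e :: p) ++ (f :: q)).
Proof.
rewrite /= !rcons_path cat_path last_cat /=.
by move=> /andP[-> _] /andP[-> _] -> ->.
Qed.

(* Away from the leaves, if both splicings created a reversal then one of the two
   walks would already contain one. *)
Lemma merge_at e f (p q : seq (darc Q)) : dstart e = dstart f ->
  cycle good_step (e :: p) -> cycle good_step (f :: q) ->
  cycle good_step ((e :: p) ++ (f :: q)) \/
  cycle good_step ((e :: p) ++ rev_walk (f :: q)).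
Proof.
move=> ef c1 c2.
have [r rE rlast] := rev_walk_cons f q.
have := c2; rewrite -cycle_rev_walk rE => c3.
have g1 : good_step (last e p) e by move: c1; rewrite /= rcons_path => /andP[].
have g2 : good_step (last f q) f by move: c2; rewrite /= rcons_path => /andP[].
move: g1 g2; rewrite /good_step !reversalE => /andP[/eqP d1 n1] /andP[/eqP d2 n2].
have [lx|nlx] := boolP (leaf (dstart e)).
  left; apply: cat_good => //; rewrite /good_step /consecutive ?d1 ?d2.
    by rewrite ef eqxx -ef lx implybT.
  by rewrite ef eqxx -ef lx implybT.
rewrite d1 (negPf nlx) implybF in n1; rewrite d2 -ef (negPf nlx) implybF in n2.
set A := last e p in d1 n1 *; set C := last f q in d2 n2 rE rlast c3 *.
have [g1|b1] := boolP (good_step A f && good_step C e).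
  by left; case/andP: g1 => *; exact: cat_good.
right; apply: cat_good => //.
  rewrite /good_step /consecutive dstart_flip d1 d2 ef eqxx -ef (negPf nlx).
  rewrite implybF reversalE; apply/negP => /eqP h.
  have CA : C = A by rewrite -(flipK C) h flipK.
  move: b1; rewrite /good_step /consecutive !reversalE d1 d2 ef eqxx -ef CA.
  by rewrite (negPf nlx) !implybF n1 -CA n2.
rewrite rlast /good_step /consecutive dend_flip ef eqxx -ef (negPf nlx).
rewrite implybF reversalE flipK; apply/negP => /eqP h.
move: b1; rewrite /good_step /consecutive !reversalE d1 d2 -h eqxx.
by rewrite (negPf nlx) !implybF n1 h n2.
Qed.

Definition twice_covered ws :=
  forall a, count (fun e : darc Q => e.1 == a) (flatten ws) = 2%N.

(** Induction on the number of walks: the first one is spliced, by [merge_at], with another one that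
    shares a node with it. *)
Lemma merge_walks n ws : (size ws <= n)%N ->
  (forall w, w \in ws -> cycle good_step w) -> [::] \notin ws ->
  twice_covered ws -> exists2 w, cycle good_step w & twice_covered [:: w].
Proof.
elim: n ws => [|n IH] [|w1 ws] //=.
- by move=> _ _ _ /(_ (enum_val (Ordinal (has_arc Q)))).
- by move=> _ _ _ /(_ (enum_val (Ordinal (has_arc Q)))).
case: ws => [|w0 ws0] sz cws.
  by move=> _ cov; exists w1 => //; apply: cws; rewrite mem_head.
set ws := w0 :: ws0 in sz cws *; rewrite inE negb_or => /andP[w1n wsn] cov.
have cons w e f : w \in w1 :: ws -> cycle (@consecutive R Q) w.
  by move=> /cws; apply: sub_cycle => ? ? /andP[].
(* Otherwise every arc has both ends or neither among the nodes of [w1]. By connectedness [w1] then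
   visits all nodes, in particular one of [w0]. *)
have [x [w2 [w2ws [e ew1 ex] [f fw2 fx]]]] : exists x, exists w2,
    [/\ w2 \in ws, exists2 e, e \in w1 & dstart e = x
      & exists2 f, f \in w2 & dstart f = x].
  apply: contrapT => H.
  pose N := [pred x | has (fun e => dstart e == x) w1].
  have allN : forall v, N v.
    have [e0 e0w] : exists e0, e0 \in w1.
      by case: (w1) w1n => // e0 p _; exists e0; rewrite mem_head.
    apply: (@closed_nodes _ _ N (dstart e0)); last first.
      by apply/hasP; exists e0.
    move=> a.
    have : has (fun e : darc Q => e.1 == a) (flatten (w1 :: ws)).
      by rewrite has_count cov.
    move=> /hasP[e /flattenP[w ww ew] /eqP ea].
    have h1 : exists2 g, g \in w & dstart g = dstart e by exists e.
    have h2 := dend_in (cons w e e ww) ew.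
    suff : N (dstart e) = N (dend e).
      by move: ea; case: (e) => b [] /= -> //; rewrite /dstart /dend/=.
    move: ww; rewrite inE => /predU1P[ww|ww].
      move: h1 h2; rewrite ww => -[g gw gE] [g' gw' gE'].
      transitivity true; last apply/esym.
        by apply/hasP; exists g => //; apply/eqP.
      by apply/hasP; exists g' => //; apply/eqP.
    transitivity false; last apply/esym; apply/negP => /hasP[k kw1 /eqP kE].
      by apply: H; exists (dstart e), w; split=> //; exists k.
    by apply: H; exists (dend e), w; split=> //; exists k.
  have w0ws : w0 \in ws by rewrite mem_head.
  have : w0 != [::] by apply: contraNneq wsn => <-.
  case w0E : w0 => [//|g p] _; rewrite w0E in w0ws.
  have /hasP[k kw1 /eqP kE] := allN (dstart g).
  apply: H; exists (dstart g), (g :: p); split=> //; first by exists k.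
  by exists g; rewrite ?mem_head.
have [i p1 rot1] := rot_to ew1; have [j p2 rot2] := rot_to fw2.
have c1 : cycle good_step (e :: p1).
  by rewrite -rot1 rot_cycle; apply: cws; rewrite mem_head.
have c2 : cycle good_step (f :: p2).
  by rewrite -rot2 rot_cycle; apply: cws; rewrite inE w2ws orbT.
have [w [cw wn wc]] : exists w, [/\ cycle good_step w, w != [::] &
    forall a, count (fun e : darc Q => e.1 == a) w =
     (count (fun e : darc Q => e.1 == a) w1 +
      count (fun e : darc Q => e.1 == a) w2)%N].
  have cnt1 a : count (fun e : darc Q => e.1 == a) w1 =
      count (fun e : darc Q => e.1 == a) (e :: p1).
    by rewrite -rot1; apply/permP; rewrite perm_sym perm_rot.
  have cnt2 a : count (fun e : darc Q => e.1 == a) w2 =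
      count (fun e : darc Q => e.1 == a) (f :: p2).
    by rewrite -rot2; apply/permP; rewrite perm_sym perm_rot.
  have [|c|c] := merge_at _ c1 c2; first by rewrite ex fx.
    by exists ((e :: p1) ++ f :: p2); split=> // a; rewrite count_cat cnt1 cnt2.
  exists ((e :: p1) ++ rev_walk (f :: p2)); split=> // a.
  by rewrite count_cat count_rev_walk cnt1 cnt2.
have pr := perm_to_rem w2ws.
apply: (IH (w :: rem w2 ws)).
- by rewrite -[size _]/(size (rem w2 ws)).+1 size_rem.
- move=> v; rewrite inE => /predU1P[->//|/mem_rem vws].
  by apply: cws; rewrite inE vws orbT.
- rewrite inE negb_or eq_sym wn; apply: contraNN wsn; exact: mem_rem.
have cntE (P : pred (darc Q)) v vs :
    count P (flatten (v :: vs)) = (count P v + count P (flatten vs))%N.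
  by rewrite /= count_cat.
move=> a; rewrite -(cov a) (cntE _ w1 ws) (permP (perm_flatten pr)).
by rewrite (cntE _ w) (cntE _ w2) wc addnA.
Qed.

(* Face tracing: on arriving at a node, leave by the dart that follows the
   reversed incoming one in a cyclic order around the node. *)
Definition face_next e : darc Q :=
  next (enum [set f : darc Q | dstart f == dend e]%SET) (flip e).

Let flip_in e : flip e \in enum [set f : darc Q | dstart f == dend e]%SET.
Proof. by rewrite mem_enum inE dstart_flip. Qed.

Lemma dstart_face_next e : dstart (face_next e) = dend e.
Proof.
have : face_next e \in enum [set f : darc Q | dstart f == dend e]%SET.
  by rewrite mem_next flip_in.
by rewrite mem_enum inE => /eqP.
Qed.

(** Darts with the same successor end at the same node, and [next] is invertible on the cyclic order
    there. *)
Lemma face_next_inj : injective face_next.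
Proof.
move=> e f h; have := dstart_face_next e; rewrite h dstart_face_next => ef.
move: h; rewrite /face_next ef => /(can_inj (prev_next (enum_uniq _))) h.
by rewrite -(flipK e) h flipK.
Qed.

(** A fixed point of [next] on a duplicate-free cyclic list forces that list to have a single
    element. *)
Lemma face_next_flip e : face_next e = flip e -> leaf (dend e).
Proof.
rewrite /face_next /leaf degreeE cardE.
set s := enum _; have us : uniq s := enum_uniq _.
have [i p rotE] := rot_to (flip_in e).
rewrite -(next_rot i us) rotE -(size_rot i) rotE.
case: p rotE => //= f p rotE; rewrite eqxx => fe.
by move: us; rewrite -(rot_uniq i) rotE fe /= mem_head.
Qed.

Lemma good_face_next e : good_step e (face_next e).
Proof.
rewrite /good_step /consecutive dstart_face_next eqxx reversalE/=.
by apply/implyP => /eqP/face_next_flip.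
Qed.

Lemma count_darts a : count (fun e : darc Q => e.1 == a) (enum {: darc Q}) = 2%N.
Proof.
rewrite -sum1_count big_enum_cond/= big_mkcond/=.
rewrite (eq_bigr (fun e : arc Q * bool =>
  (fun b (_ : bool) => if b == a then 1 else 0)%N e.1 e.2))//.
rewrite -(pair_bigA _ (fun b (_ : bool) => if b == a then 1 else 0)%N) /=.
rewrite (bigD1 a)//= big_bool eqxx big1//.
by move=> b /negPf ba; rewrite ba big1.
Qed.

(** The orbits of the permutation [face_next] partition the darts, and each arc carries two
    darts. *)
Lemma face_walks_cover :
  twice_covered [seq orbit face_next x | x <- enum (froots face_next)].
Proof.
move=> a; rewrite -(count_darts a); apply/permP/uniq_perm; last first.
- move=> e; rewrite mem_enum; apply/flattenP.
  exists (orbit face_next (froot face_next e)).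
    apply: map_f; rewrite mem_enum; exact: roots_root (fconnect_sym face_next_inj) e.
  rewrite -fconnect_orbit (fconnect_sym face_next_inj).
  exact: connect_root.
- exact: enum_uniq.
have : uniq (enum (froots face_next)) by exact: enum_uniq.
have : {subset enum (froots face_next) <= froots face_next} by move=> x; rewrite mem_enum.
elim: (enum _) => //= x s IH sub /andP[xs us].
rewrite cat_uniq orbit_uniq IH ?andbT//=; last by move=> y ys; apply: sub; rewrite inE ys orbT.
apply/hasPn => e /flattenP[_ /mapP[y ys ->]] /=.
rewrite -!fconnect_orbit => ye; apply/negP => xe.
have rx : froot face_next x = x by apply/eqP; apply: sub; rewrite mem_head.
have ry : froot face_next y = y by apply/eqP; apply: sub; rewrite inE ys orbT.
have /(fingraph.rootP (fconnect_sym face_next_inj)) := xe.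
have /(fingraph.rootP (fconnect_sym face_next_inj)) := ye.
by rewrite rx ry => yE xE; move: xs; rewrite xE -yE ys.
Qed.

Lemma double_tour_exists : exists w, double_tour w.
Proof.
have [||w cw cov] := @merge_walks _ _ (leqnn _) _ _ face_walks_cover.
- move=> _ /mapP[x _ ->]; apply: sub_cycle (cycle_orbit face_next_inj x).
  by move=> e f /eqP <-; exact: good_face_next.
- by apply/mapP => -[x _] /esym/eqP; rewrite -size_eq0 size_orbit -orderSpred.
exists w; apply/and3P; split.
- by apply: sub_cycle cw => e f /andP[].
- apply: sub_cycle cw => e f /andP[_ /implyP h]; apply/implyP => /h.
  by rewrite leaf_arc_dart => ->; rewrite orbT.
by apply/forallP => a; rewrite -(cov a) /= cats0.
Qed.

End Tours.

(** * Closed walks and the girth *)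

(** The split is at the first occurrence; the equation on counts records this and allows [v] to be
    split again. *)
Lemma count_split (T : Type) (P : pred T) (s : seq T) : (0 < count P s)%N ->
  exists u e v, [/\ s = u ++ e :: v, P e & (count P v).+1 = count P s].
Proof.
elim: s => //= x s IH; case Px : (P x); first by move=> _; exists [::], x, s.
by rewrite add0n => /IH[u [e [v [-> Pe h]]]]; exists (x :: u), e, v.
Qed.

Lemma count_split2 (T : Type) (P : pred T) (s : seq T) : (1 < count P s)%N ->
  exists u1 e1 u2 e2 u3,
    [/\ s = u1 ++ e1 :: u2 ++ e2 :: u3, P e1 & P e2].
Proof.
move=> c2; have [|u1 [e1 [v [sE P1 cv]]]] := @count_split _ P s; first exact: ltnW.
have [|u2 [e2 [u3 [vE P2 _]]]] := @count_split _ P v; first by rewrite -cv in c2.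
by exists u1, e1, u2, e2, u3; rewrite sE vE.
Qed.

Lemma not_uniq_split (T : Type) (U : eqType) (h : T -> U) (s : seq T) :
  ~~ uniq (map h s) -> exists u1 e1 u2 e2 u3,
    s = u1 ++ e1 :: u2 ++ e2 :: u3 /\ h e1 = h e2.
Proof.
elim: s => //= x s IH; rewrite negb_and negbK => /orP[|].
  move=> hx; have [|u [e [v [sE /eqP he _]]]] := @count_split _ (fun y => h y == h x) s.
    by rewrite -has_count; move: hx; rewrite -has_pred1 has_map.
  by exists [::], x, u, e, v; rewrite sE.
by move=> /IH[u1 [e1 [u2 [e2 [u3 [-> ?]]]]]]; exists (x :: u1), e1, u2, e2, u3.
Qed.

Lemma not_sorted_split (T : Type) (r : rel T) (s : seq T) : ~~ sorted r s ->
  exists u e f v, s = u ++ e :: f :: v /\ ~~ r e f.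
Proof.
elim: s => // x [//|y s] IH /=; rewrite negb_and => /orP[rxy|/IH].
  by exists [::], x, y, s.
by move=> [u [e [f [v [-> ?]]]]]; exists (x :: u), e, f, v.
Qed.

Section ClosedWalks.
Variables (R : realType) (Q : network R).
Implicit Types (e f : darc Q) (w : seq (darc Q)).

Definition walk_len w : R := \sum_(e <- w) len e.1.

Lemma walk_len_cat w w' : walk_len (w ++ w') = walk_len w + walk_len w'.
Proof. by rewrite /walk_len big_cat. Qed.

Lemma walk_len_cons e w : walk_len (e :: w) = len e.1 + walk_len w.
Proof. by rewrite /walk_len big_cons. Qed.

Lemma walk_len_ge0 w : 0 <= walk_len w.
Proof. by apply: sumr_ge0 => e _; exact/ltW/len_gt0. Qed.

Lemma closed_subwalk u1 e u2 f u3 :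
  sorted (@consecutive R Q) (u1 ++ e :: u2 ++ f :: u3) -> dstart e = dstart f ->
  cycle (@consecutive R Q) (e :: u2).
Proof.
move=> + ef => /(cat_sorted2 (s := u1))[_] /=.
rewrite cat_path rcons_path /= => /and3P[-> h _] /=.
by move: h; rewrite /consecutive ef.
Qed.

(** Induction on the size. A repeated start node cuts out a shorter closed walk. If the start nodes
    are distinct, an arc could recur only in the opposite direction, which is an immediate reversal
    or repeats a start node. Reversals are excluded by [sorted] and not [cycle], because a piece
    that is cut out may turn back at its base node. *)
Lemma circuit_below w : w != [::] -> cycle (@consecutive R Q) w ->
  sorted (fun e f => ~~ reversal e f) w ->
  exists2 c, circuit c & walk_len c <= walk_len w.
Proof.
have [n] := ubnP (size w); elim: n w => // n IH w; rewrite ltnS => sz w0 cw sw.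
have sortw : sorted (@consecutive R Q) w.
  by case: (w) cw => //= e p; rewrite rcons_path => /andP[].
have [un|/not_uniq_split[u1 [e [u2 [f [u3 [wE ef]]]]]]] :=
  boolP (uniq (map (@dstart R Q) w)); last first.
  have [||||c cc lc] := IH (e :: u2).
  - rewrite wE size_cat /= size_cat /= in sz; apply: leq_trans sz.
    by rewrite !addnS !ltnS addnCA leq_addr.
  - by [].
  - by rewrite wE in sortw; exact: closed_subwalk sortw ef.
  - move: sw; rewrite wE => /(cat_sorted2 (s := u1))[_].
    by rewrite -cat_cons => /cat_sorted2[].
  exists c => //; apply: le_trans lc _.
  rewrite wE !(walk_len_cat, walk_len_cons).
  have := walk_len_ge0 u1; have := walk_len_ge0 u3; have := len_gt0 f.1; lra.
exists w => //; apply/and3P; split => //.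
apply: contraT => /not_uniq_split[u1 [e [u2 [f [u3 [wE ef]]]]]].
move: un sw sortw; rewrite wE map_cat /= map_cat /= cat_uniq => /and3P[_ _ /=].
rewrite mem_cat inE !negb_or cat_uniq => /andP[/and3P[_ ne _] /and3P[_ h _]].
move=> /(cat_sorted2 (s := u1))[_] sw /(cat_sorted2 (s := u1))[_] cs.
have [fe|fe] := same_arc (esym ef).
  by rewrite fe eqxx in ne.
case: u2 h sw cs {wE ef} => [|g u2] /=.
  by move=> _; rewrite reversalE fe eqxx.
rewrite negb_or in_cons negb_or => /andP[/andP[fg _] _] _ /andP[/eqP eg _].
by rewrite fe dstart_flip eg eqxx in fg.
Qed.

Variable alpha : {posnum R}.
Hypothesis h_girth : ((alpha%:num)%:E <= girth Q)%E.

Lemma le_circuit w : circuit w -> alpha%:num <= walk_len w.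
Proof.
move=> cw; rewrite -lee_fin; apply: le_trans h_girth _.
by apply: ereal_inf_lbound; left; exists w.
Qed.

Lemma le_leaf_arc (a : arc Q) : leaf_arc a -> alpha%:num <= 2 * len a.
Proof.
move=> la; rewrite -lee_fin; apply: le_trans h_girth _.
by apply: ereal_inf_lbound; right; exists a.
Qed.

Definition tour_step e f := reversal e f ==> leaf_arc e.1.

(** Without a reversal the walk is at least as long as a circuit. A reversal means that a leaf arc
    is traversed twice, and the generalized girth bounds twice its length. *)
Lemma le_closed_walk w : w != [::] -> cycle (@consecutive R Q) w ->
  sorted tour_step w -> alpha%:num <= walk_len w.
Proof.
move=> w0 cw sw.
have [s|/not_sorted_split[u [e [f [v [wE]]]]]] :=
  boolP (sorted (fun e f => ~~ reversal e f) w).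
  by have [c /le_circuit h1 h2] := circuit_below w0 cw s; exact: le_trans h2.
rewrite negbK => ref.
have lef : leaf_arc e.1.
  by move: sw; rewrite wE => /(cat_sorted2 (s := u))[_] /= /andP[/implyP h _]; exact: h.
have fe : f.1 = e.1 by case/andP: ref => /eqP.
have := le_leaf_arc lef; rewrite wE !(walk_len_cat, walk_len_cons) fe.
have := walk_len_ge0 u; have := walk_len_ge0 v; lra.
Qed.

End ClosedWalks.

(** * Visits of a tour *)

Section Follow.
Variables (R : realType) (Q : network R) (beta : {nonneg R}).
Implicit Types (e f : darc Q) (w u v : seq (darc Q)) (p : netpoint Q).

Lemma follow_time_cat u v :
  follow_time beta (u ++ v) = follow_time beta u + follow_time beta v.
Proof. by rewrite /follow_time big_cat. Qed.

Lemma follow_time_cons e v :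
  follow_time beta (e :: v) = len e.1 + pause beta e + follow_time beta v.
Proof. by rewrite /follow_time big_cons. Qed.

Lemma walk_len_le_time w : walk_len w <= follow_time beta w.
Proof. by apply: ler_sum => e _; rewrite lerDl pause_ge0. Qed.

Lemma follow_time_ge0 w : 0 <= follow_time beta w.
Proof. exact: le_trans (walk_len_ge0 w) (walk_len_le_time w). Qed.

(** At the exact time [follow_time beta u] a nonempty [u] still determines the position, hence the
    condition [0 < y]. *)
Lemma follow_skip u e v p y : 0 < y ->
  follow beta (u ++ e :: v) p (follow_time beta u + y) = follow beta (e :: v) p y.
Proof.
move=> y0; elim: u p => [|f u IH] p; first by rewrite /follow_time big_nil add0r.
have u0 := follow_time_ge0 u; have f0 := pause_ge0 beta f.
rewrite follow_time_cons [LHS]/= !ifF.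
- rewrite [X in follow _ _ _ X](_ : _ = follow_time beta u + y); first exact: IH.
  ring.
- by apply/negbTE; rewrite -ltNge; lra.
- by apply/negbTE; rewrite -ltNge; lra.
Qed.

Lemma follow_arc e v p y : y <= len e.1 ->
  follow beta (e :: v) p y = along e.1 (if e.2 then y else len e.1 - y).
Proof. by move=> /= ->. Qed.

Lemma follow_pause e v p y : 0 <= y <= pause beta e ->
  follow beta (e :: v) p (len e.1 + y) = npoint (dend e).
Proof.
move=> /andP[y0 yp] /=; rewrite lerD2l yp; case: ifP => // h.
have -> : y = 0 by lra.
by rewrite addr0 along_dend.
Qed.

End Follow.

Section TourCounts.
Variables (R : realType) (Q : network R) (w : seq (darc Q)).
Hypothesis tour_w : double_tour w.

Let twice a : count (fun e : darc Q => e.1 == a) w = 2%N.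
Proof. by case/and3P: tour_w => _ _ /forallP/(_ a)/eqP. Qed.

Lemma sum_tour (g : arc Q -> R) : \sum_(e <- w) g e.1 = 2 * \sum_a g a.
Proof.
rewrite (eq_bigr (fun e : darc Q => \sum_a (if e.1 == a then g a else 0))); last first.
  move=> e _; rewrite (bigD1 e.1)//= eqxx big1 ?addr0// => a.
  by rewrite eq_sym => /negPf ->.
rewrite exchange_big/= mulr_sumr; apply: eq_bigr => a _.
rewrite -big_mkcond/= big_const_seq iter_addr addr0.
by rewrite [count _ _](twice a) mulr_natl.
Qed.

Lemma count_natr (P : pred (darc Q)) :
  (count P w)%:R = \sum_(e <- w) (P e)%:R :> R.
Proof. by rewrite -sum1_count natr_sum big_mkcond /=; apply: eq_bigr => e _; case: (P e). Qed.

(** A closed walk has as many darts ending at [v] as starting there. The sum of the two counts does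
    not depend on the directions of the darts, so [sum_tour] evaluates it. *)
Lemma count_dend v : count (fun e : darc Q => dend e == v) w = degree v.
Proof.
have cw : cycle (@consecutive R Q) w by case/and3P: tour_w.
have h : count (fun e : darc Q => dend e == v) w = count (fun e : darc Q => dstart e == v) w.
  rewrite -[LHS](count_map (@dend R Q) (pred1 v)) -[RHS](count_map (@dstart R Q) (pred1 v)).
  by rewrite map_dend//; apply/permP; rewrite perm_rot.
apply/eqP; rewrite -(eqr_nat R).
suff : 2 * (count (fun e : darc Q => dend e == v) w)%:R = 2 * (degree v)%:R :> R.
  by move=> /mulfI-> //; rewrite pnatr_eq0.
rewrite [LHS]mulr_natl [LHS]mulr2n {2}h !count_natr -big_split/=.
rewrite (eq_bigr (fun e : darc Q =>
  (fun a => (src a == v)%:R + (dst a == v)%:R) e.1)); last first.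
  by move=> -[a []] _ //=; rewrite addrC.
rewrite (sum_tour (fun a => (src a == v)%:R + (dst a == v)%:R)); congr (_ * _).
rewrite big_split/= /degree natrD -!sum1_card !natr_sum.
by congr (_ + _); rewrite [RHS]big_mkcond; apply: eq_bigr => a _; rewrite inE; case: ifP.
Qed.

(** A leaf has degree one, so the tour arrives at it, and stops there, exactly once. *)
Lemma follow_time_tour (beta : {nonneg R}) : follow_time beta w =
  2 * mu Q + #|[set v : node Q | leaf v]%SET|%:R * beta%:num.
Proof.
rewrite /follow_time big_split/= (sum_tour (@len R Q)) /mu lambdaT/=; congr (_ + _).
rewrite (eq_bigr (fun e : darc Q => (leaf (dend e))%:R * beta%:num)); last first.
  by move=> e _; rewrite /pause; case: ifP; rewrite ?mul1r ?mul0r.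
rewrite -mulr_suml -(count_natr (fun e => leaf (dend e))); congr (_%:R * _).
rewrite -sum1_count -sum1_card.
rewrite (partition_big (@dend R Q) (@leaf R Q))//= [RHS](eq_bigl (@leaf R Q)); last first.
  by move=> v; rewrite inE.
apply: eq_bigr => v lv.
rewrite (eq_bigl (fun e : darc Q => dend e == v)); last first.
  by move=> e; case: eqP => [->|]; rewrite ?lv ?andbF.
by rewrite sum1_count count_dend; apply/eqP.
Qed.

End TourCounts.

Section Gaps.
Variables (R : realType) (Q : network R) (alpha : {posnum R}) (beta : {nonneg R}).
Hypothesis h_girth : ((alpha%:num)%:E <= girth Q)%E.
Hypothesis betaE : beta%:num = alpha%:num.
Local Notation al := (alpha%:num).
Local Notation ft := (follow_time beta).
Implicit Types (e f : darc Q) (w u v : seq (darc Q)).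

Lemma double_tour_rot u v : double_tour (u ++ v) -> double_tour (v ++ u).
Proof.
rewrite -(rot_size_cat u v) => /and3P[c1 c2 c3]; apply/and3P.
rewrite !rot_cycle c1 c2; split=> //; apply/forallP => a.
have /forallP/(_ a)/eqP <- := c3; apply/eqP.
by apply/permP; rewrite perm_rot.
Qed.

Lemma tour_sorted w : double_tour w ->
  sorted (@consecutive R Q) w /\ sorted (@tour_step R Q) w.
Proof.
case: w => // e w /and3P[c1 c2 _]; move: c1 c2.
by rewrite /= !rcons_path => /andP[-> _] /andP[-> _].
Qed.

(** Between the arrivals at the ends of [e] and of [f] the tour follows the closed walk
    [rcons u f]. *)
Lemma node_gap e u f v : double_tour (e :: u ++ f :: v) -> dend e = dend f ->
  al <= pause beta e + ft u + len f.1.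
Proof.
move=> tw ef; have [sc ss] := tour_sorted tw.
have : al <= walk_len (rcons u f).
  have pc : path (@consecutive R Q) e (rcons u f).
    by move: sc; rewrite /= -cat_rcons cat_path => /andP[].
  have st : sorted (@tour_step R Q) (rcons u f).
    by move: ss; rewrite /= -cat_rcons => /path_sorted/cat_sorted2[].
  have lst : last e (rcons u f) = f by rewrite last_rcons.
  apply: (le_closed_walk h_girth) => //; first by case: (u).
  case: (rcons u f) pc lst {st} => //= g p /andP[eg gp] lst.
  by rewrite rcons_path gp lst /= /consecutive -ef; exact: eg.
rewrite -cats1 walk_len_cat {2}/walk_len big_seq1 => h.
have := walk_len_le_time beta u; have := pause_ge0 beta e; lra.
Qed.

Lemma closed_walk_time w : w != [::] -> cycle (@consecutive R Q) w ->
  sorted (@tour_step R Q) w -> al <= ft w.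
Proof.
by move=> w0 cw sw; apply: le_trans (walk_len_le_time _ _); exact: le_closed_walk sw.
Qed.

(* A tour never turns back on a leaf arc at its inner end: it could not have
   entered that arc before. *)
Lemma leaf_reversal e v : double_tour (e :: flip e :: v) -> leaf (dend e).
Proof.
move=> tw; apply/negPn/negP => nl.
have [_ ss] := tour_sorted tw.
have ls : leaf (dstart e).
  move: ss; rewrite /= /tour_step reversalE eqxx /= leaf_arc_dart (negPf nl) orbF.
  by case/andP.
case/and3P: (tw) => cw _ /forallP cnt.
have notin f : f \in v -> f.1 != e.1.
  move=> fv; apply/negP => /eqP fe; have := cnt e.1; rewrite /= eqxx /= !add1n !eqSS.
  by rewrite -leqn0 leqNgt -has_count => /negP; apply; apply/hasP; exists f; rewrite ?fe.
case/lastP: v => [|v g] in tw cw cnt notin {ss} *; last first.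
  have : consecutive g e.
    by move: cw; rewrite /= !rcons_path last_rcons => /and3P[].
  move=> /eqP ge; have := notin g; rewrite mem_rcons mem_head => /(_ isT).
  have := leaf_dart (f := flip g) ls; rewrite dstart_flip ge => /(_ erefl) <-.
  by rewrite eqxx.
have all_e f : f.1 = e.1.
  by apply/eqP; have := cnt f.1; rewrite /= (eq_sym e.1); case: (f.1 == e.1).
move: nl; apply/negP; rewrite negbK /leaf degreeE; apply/cards1P; exists (flip e).
apply/setP => f; rewrite !inE; apply/eqP/eqP => [fe|->]; last by rewrite dstart_flip.
have [fE|//] := same_arc (all_e f).
by have := leaf_dend_neq ls; rewrite -fe fE eqxx.
Qed.

(** The right-hand side is the time between the passages of [e] and of [f] at abscissa [y]. If they
    have the same direction, [e :: u] is a closed walk. Otherwise [u] is a closed walk or is empty,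
    and in the latter case the tour turns at a leaf and stops for [al]. *)
Lemma arc_gap e u f v y : double_tour (e :: u ++ f :: v) -> f.1 = e.1 ->
  0 < y < len e.1 ->
  al <= len e.1 - (if e.2 then y else len e.1 - y) + pause beta e + ft u
        + (if f.2 then y else len f.1 - y).
Proof.
move=> tw fe /andP[y0 yl]; have [sc ss] := tour_sorted tw.
have u0 := follow_time_ge0 beta u; have p0 := pause_ge0 beta e.
have [fE|fE] := same_arc fe.
  have h : al <= walk_len (e :: u).
    apply: (le_closed_walk h_girth) => //.
      by apply: (closed_subwalk (u1 := [::])) sc _; rewrite fE.
    by move: ss; rewrite -cat_cons => /cat_sorted2[].
  move: h; rewrite walk_len_cons fE; have := walk_len_le_time beta u.
  by case: ifP => _; lra.
rewrite fE /=; suff : al <= pause beta e + ft u by case: (e.2) => /=; lra.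
case: u => [|g u] in tw sc ss u0 *.
  by rewrite /= fE in tw; rewrite /pause (leaf_reversal tw) betaE lerDl.
suff : al <= ft (g :: u) by lra.
apply: closed_walk_time => //.
  apply: (closed_subwalk (u1 := [:: e]) sc).
  by move: sc => /= /andP[/eqP <- _]; rewrite fE dstart_flip.
by move: ss => /= /andP[_]; rewrite cat_path => /andP[].
Qed.

Variables (w : seq (darc Q)) (tour_w : double_tour w).
Local Notation c := (tour_path beta tour_w).

Let trace_at u e v y : w = u ++ e :: v -> 0 < y ->
  exists p, c (ft u + y) = follow beta (e :: v) p y.
Proof.
move=> wE y0; exists (if w is e :: _ then npoint (dstart e) else point).
by rewrite -(follow_skip beta u e v _ y0) -wE.
Qed.

Let trace_dend u e v z : w = u ++ e :: v -> 0 <= z <= pause beta e ->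
  c (ft u + (len e.1 + z)) = npoint (dend e).
Proof.
move=> wE /[dup] hz /andP[z0 _]; have l0 := len_gt0 e.1.
have [|p ->] := trace_at (y := len e.1 + z) wE; first by lra.
exact: follow_pause.
Qed.

Let trace_arc u e v y : w = u ++ e :: v -> 0 < y < len e.1 ->
  c (ft u + (if e.2 then y else len e.1 - y)) = along e.1 y.
Proof.
move=> wE /andP[y0 yl].
have [|p ->] := trace_at (y := if e.2 then y else len e.1 - y) wE.
  by case: ifP => _; lra.
rewrite follow_arc; last by case: ifP => _; lra.
by case: (e.2); rewrite ?subKr.
Qed.

Lemma tour_visits (x : netpoint Q) : exists s1 s2,
  [/\ 0 <= s1, s1 + al <= s2, s2 <= period c, s2 + al <= s1 + period c
    & c s1 = x /\ c s2 = x].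
Proof.
have -> : period c = ft w by [].
have al0 : 0 < al by exact: (gt0 alpha).
case: x => [v|i]; last first.
  rewrite -along_inner; set a := (val i).1; set y := (val i).2.
  have hy : 0 < y < len a by exact: (valP i).
  have /andP[y0 yl] := hy.
  have : (1 < count (fun e : darc Q => e.1 == a) w)%N.
    by case/and3P: tour_w => _ _ /forallP/(_ a)/eqP->.
  move=> /count_split2[u1 [e [u2 [f [u3 [wE /eqP ea /eqP fa]]]]]].
  (* Two rotations of the tour give the two gaps, one in each cyclic direction. *)
  have tw1 : double_tour (e :: u2 ++ f :: (u3 ++ u1)).
    by have := tour_w; rewrite wE => /double_tour_rot; rewrite /= -catA.
  have tw2 : double_tour (f :: (u3 ++ u1) ++ e :: u2).
    have := tour_w; rewrite wE -cat_cons catA => /double_tour_rot.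
    by rewrite /= -catA.
  have hye : 0 < y < len e.1 by rewrite ea.
  have hyf : 0 < y < len f.1 by rewrite fa.
  have fe : f.1 = e.1 by rewrite ea fa.
  have g1 := arc_gap tw1 fe hye.
  have g2 := arc_gap tw2 (esym fe) hyf.
  rewrite follow_time_cat in g2.
  have wE2 : w = (u1 ++ e :: u2) ++ f :: u3 by rewrite wE -catA.
  have t1 := trace_arc wE hye; have t2 := trace_arc wE2 hyf.
  exists (ft u1 + (if e.2 then y else len e.1 - y)),
    (ft (u1 ++ e :: u2) + (if f.2 then y else len f.1 - y)).
  rewrite t1 t2 ea fa.
  have k1 := follow_time_ge0 beta u1; have k2 := follow_time_ge0 beta u2.
  have k3 := follow_time_ge0 beta u3.
  have p1 := pause_ge0 beta e; have p2 := pause_ge0 beta f.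
  rewrite wE2 !(follow_time_cat, follow_time_cons).
  rewrite fe ea in g1 g2 yl hye hyf *; move: g1 g2.
  by case: (e.2); case: (f.2) => g1 g2; split=> //; lra.
have [lv|nlv] := boolP (leaf v).
  have : (0 < count (fun e : darc Q => dend e == v) w)%N.
    by rewrite count_dend ?degree_gt0.
  move=> /count_split[u1 [e [u2 [wE /eqP ev _]]]].
  have pe : pause beta e = al by rewrite /pause ev lv betaE.
  (* At a leaf the two times are the ends of the single stop. The rest of the tour lasts at least
     [al], since the leaf arc is traversed twice. *)
  exists (ft u1 + (len e.1 + 0)), (ft u1 + (len e.1 + al)).
  rewrite !(trace_dend wE) ?ev; first last.
  - by rewrite pe lexx ltW.
  - by rewrite pe lexx ltW.
  have la : al <= 2 * len e.1.
    by apply: (le_leaf_arc h_girth); rewrite leaf_arc_dart ev lv orbT.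
  have k1 := follow_time_ge0 beta u1; have k2 := follow_time_ge0 beta u2.
  have l0 := len_gt0 e.1.
  have k : 2 * len e.1 <= walk_len w.
    rewrite /walk_len (sum_tour tour_w (@len R Q)) ler_pM2l//.
    by rewrite (bigD1 e.1)//= lerDl sumr_ge0// => b _; rewrite ltW// len_gt0.
  have h1 := walk_len_le_time beta u1; have h2 := walk_len_le_time beta u2.
  rewrite wE walk_len_cat walk_len_cons in k.
  split=> //; rewrite ?wE ?(follow_time_cat, follow_time_cons) ?pe; lra.
have : (1 < count (fun e : darc Q => dend e == v) w)%N.
  rewrite count_dend//; have := degree_gt0 v; have := no_degree2 v.
  by move: nlv; rewrite /leaf -/(degree v); case: (degree v) => [|[|]].
move=> /count_split2[u1 [e [u2 [f [u3 [wE /eqP ev /eqP fv]]]]]].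
have tw1 : double_tour (e :: u2 ++ f :: (u3 ++ u1)).
  by have := tour_w; rewrite wE => /double_tour_rot; rewrite /= -catA.
have tw2 : double_tour (f :: (u3 ++ u1) ++ e :: u2).
  have := tour_w; rewrite wE -cat_cons catA => /double_tour_rot.
  by rewrite /= -catA.
have ef : dend e = dend f by rewrite ev fv.
have g1 := node_gap tw1 ef; have g2 := node_gap tw2 (esym ef).
rewrite follow_time_cat in g2.
have wE2 : w = (u1 ++ e :: u2) ++ f :: u3 by rewrite wE -catA.
have pe : pause beta e = 0 by rewrite /pause ev (negPf nlv).
have pf : pause beta f = 0 by rewrite /pause fv (negPf nlv).
exists (ft u1 + (len e.1 + 0)), (ft (u1 ++ e :: u2) + (len f.1 + 0)).
rewrite (trace_dend wE) ?ev; last by rewrite pe lexx.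
rewrite (trace_dend wE2) ?fv; last by rewrite pf lexx.
have k1 := follow_time_ge0 beta u1; have k2 := follow_time_ge0 beta u2.
have k3 := follow_time_ge0 beta u3.
have l1 := len_gt0 e.1; have l2 := len_gt0 f.1.
by split=> //; rewrite ?wE2 ?(follow_time_cat, follow_time_cons) ?pe ?pf; lra.
Qed.

End Gaps.

(** * The random extension of a tour *)

Section RandomExtension.
Variables (R : realType) (Q : network R) (alpha : {posnum R}) (c : closed_path Q).
Local Notation al := (alpha%:num).
Local Notation L := (period c).
Local Notation leb := (@lebesgue_measure R).
Variables (q : netpoint Q) (tau : time R).

Let L_gt0 : 0 < L. Proof. exact: period_gt0. Qed.

Lemma wrap_shift (x : R) (k : int) : wrap L (x + L * k%:~R) = wrap L x.
Proof.
rewrite /wrap mulrDl (mulrC L) mulfK ?gt_eqF// floorDrz ?intr_int//.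
by rewrite intrKfloor intrD; ring.
Qed.

Lemma trace_wrap s : 0 <= s <= L -> c (wrap L s) = c s.
Proof.
move=> /andP[s0]; rewrite le_eqVlt => /predU1P[->|sL].
  rewrite -trace_closed /wrap divff ?gt_eqF// floor1 mulr1 subrr.
  by [].
have fE : Num.floor (s / L) = 0.
  apply: floor_def; rewrite add0r mulr0z mulr1z ltr_pdivrMr// mul1r sL andbT.
  by rewrite divr_ge0// ltW.
by rewrite /wrap fE mulr0 subr0.
Qed.

Definition hit_shifts : set R :=
  [set D | intercepts alpha (shifted_patrol c D) (q, tau)].

Let m_hit : measurable hit_shifts.
Proof.
rewrite -[X in measurable X]setTI.
exact: (@measurable_shifted_patrol _ _ c measurableT _
  (measurable_intercepting alpha (q, tau))).
Qed.

Let hit_shift D (k : int) : hit_shifts D -> hit_shifts (D + L * k%:~R).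
Proof. by move=> [t ht Dt]; exists t => //; rewrite /= addrA wrap_shift. Qed.

(** Intercepting shifts are periodic with period [L]. The window is cut at [b], the first multiple
    of [L] beyond [a], and the two pieces are translated by multiples of [L] to disjoint parts of
    one period. *)
Lemma window_measure_le (X : set R) (a : R) :
  measurable X -> X `<=` `[a, a + L[ -> X `<=` hit_shifts ->
  (leb X <= leb (hit_shifts `&` `[0%R, L]))%E.
Proof.
move=> mX Xa XH.
pose n := Num.floor (a / L).
have /andP[n1 n2] := floor_itv (a / L).
rewrite -/n ler_pdivlMr// in n1; rewrite -/n ltr_pdivrMr// intrD mulrDl mul1r in n2.
set N := n%:~R * L in n1 n2; pose b := N + L; pose d := a - N.
have H1 : (leb (X `&` `]-oo, b[) <= leb (hit_shifts `&` `[d, L[))%E.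
  apply: (@lebesgue_measure_shift _ (- N)) => x [Xx /=]; rewrite in_itv/= => xn.
  have /Xa := Xx; rewrite /= in_itv/= => /andP[h1 h2]; split.
    by rewrite (_ : x - N = x + L * (- n)%:~R); [exact/hit_shift/XH|rewrite /N intrN; ring].
  by rewrite /= in_itv/= /d; rewrite /b in xn *; apply/andP; split; lra.
have H2 : (leb (X `&` `[b, +oo[) <= leb (hit_shifts `&` `[0%R, d[))%E.
  apply: (@lebesgue_measure_shift _ (- b)) => x [Xx /=]; rewrite in_itv/= andbT => xn.
  have /Xa := Xx; rewrite /= in_itv/= => /andP[h1 h2]; split.
    rewrite (_ : x - (N + L) = x + L * (- (n + 1))%:~R); first exact/hit_shift/XH.
    by rewrite /b /N intrN intrD; ring.
  by rewrite /= in_itv/= /d; rewrite /b in xn *; apply/andP; split; lra.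
apply: (@le_trans _ _ (leb (X `&` `]-oo, b[) + leb (X `&` `[b, +oo[))%E).
  rewrite -measureU//; [|exact: measurableI|exact: measurableI|].
    apply: le_lebesgue_measure => x Xx; rewrite -setIUr; split=> //=.
    by rewrite !in_itv/= andbT; case: (ltP x b); [left|right].
  apply/seteqP; split=> // x [[_ /= h1] [_ /= h2]].
  by move: h1 h2; rewrite !in_itv/= andbT => h1 h2; lra.
apply: le_trans (leeD H1 H2) _.
rewrite -measureU//; [|exact: measurableI|exact: measurableI|].
  apply: le_lebesgue_measure => x; rewrite -setIUr => -[Hx /= h]; split=> //=.
  by move: h; rewrite !in_itv/= /d => -[] /andP[? ?]; apply/andP; split; lra.
apply/seteqP; split=> // x [[_ /= h1] [_ /= h2]].
by move: h1 h2; rewrite !in_itv/= => /andP[? ?] /andP[? ?]; lra.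
Qed.

Lemma random_extension_ge s1 s2 :
  0 <= s1 -> s1 + al <= s2 -> s2 <= L -> s2 + al <= s1 + L ->
  c s1 = q -> c s2 = q ->
  ((2 * al / L)%:E <= random_extension c [set S | intercepts alpha S (q, tau)])%E.
Proof.
move=> s10 s12 s2L s21 c1 c2.
have al0 : 0 < al by exact: (gt0 alpha).
have tau0 : 0 <= time_val tau by exact: (ge0 tau).
pose t0 := time_val tau.
(* A shift [D] in [J s] brings the patrol to [q] at time [s - D], inside the attack window. The gap
   from [s1] to [s2] makes the two half-open intervals disjoint, and the gap from [s2] back to [s1]
   fits them into one period. *)
pose J s : set R := `[s - t0 - al, s - t0[%classic.
have JH s : 0 <= s <= L -> c s = q -> J s `<=` hit_shifts.
  move=> hs cs D; rewrite /J /= in_itv/= => /andP[D1 D2].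
  have ce : time_val (clock (s - D)) = s - D by apply: max_r; rewrite /t0 in D2; lra.
  exists (clock (s - D)).
    by rewrite ce -[time_val (q, tau).2]/t0; apply/andP; split; lra.
  rewrite -[LHS]/(c (wrap L (time_val (clock (s - D)) + D))) ce subrK.
  by rewrite trace_wrap.
have mJ s : measurable (J s) by exact: measurable_itv.
have lJ s : leb (J s) = al%:E.
  rewrite /J lebesgue_measure_itv/= lte_fin ifT; last lra.
  by rewrite -EFinD; congr EFin; lra.
rewrite /random_extension uniform_probE// subr0.
apply: (@le_trans _ _ ((L^-1)%:E * leb (J s1 `|` J s2))%E).
  have -> : (leb (J s1 `|` J s2) = leb (J s1) + leb (J s2))%E.
    apply: measureU; [exact: mJ|exact: mJ|].
    apply/seteqP; split=> // x []; rewrite /J /= !in_itv/= => /andP[? ?] /andP[? ?].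
    lra.
  by rewrite !lJ -EFinD -EFinM lee_fin mulrC mulr2n mulrDl mul1r.
apply: lee_wpmul2l; first by rewrite lee_fin invr_ge0 ltW.
apply: (@window_measure_le _ (s1 - t0 - al)).
- exact: measurableU (mJ _) (mJ _).
- by move=> x []; rewrite /J /= !in_itv/= => /andP[? ?]; apply/andP; split; lra.
- by move=> x [] Jx; [apply: (JH s1)|apply: (JH s2)] => //; apply/andP; split; lra.
Qed.

End RandomExtension.

(** * Saddle point and value of the game *)

Lemma optimal_strategies (R : realType) (Q : network R) (alpha : {posnum R})
    (P0 : probability (patrol Q) R) (A0 : probability (attack Q) R) (v : \bar R) :
  (forall A, v <= payoff alpha P0 A)%E -> (forall P, payoff alpha P A0 <= v)%E ->
  [/\ is_value Q alpha v, patroller_optimal alpha P0 & attacker_optimal alpha A0].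
Proof.
move=> vP0 A0v.
have h1 : (v <= ereal_inf (range (payoff alpha P0)))%E.
  by apply: le_ereal_inf_tmp => _ [A _ <-].
have h2 : (ereal_inf (range (payoff alpha P0)) <= lower_value Q alpha)%E.
  by apply: ereal_sup_ubound; exists P0.
have h3 : (lower_value Q alpha <= upper_value Q alpha)%E.
  apply: ge_ereal_sup => _ [P _ <-]; apply: le_ereal_inf_tmp => _ [A _ <-].
  apply: (@le_trans _ _ (payoff alpha P A)).
    by apply: ereal_inf_lbound; exists A.
  by apply: ereal_sup_ubound; exists P.
have h4 : (upper_value Q alpha <= ereal_sup (range (payoff alpha ^~ A0)))%E.
  by apply: ereal_inf_lbound; exists A0.
have h5 : (ereal_sup (range (payoff alpha ^~ A0)) <= v)%E.
  by apply: ge_ereal_sup => _ [P _ <-].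
have lE : lower_value Q alpha = v.
  by apply/le_anti; rewrite (le_trans h1 h2) (le_trans h3 (le_trans h4 h5)).
have uE : upper_value Q alpha = v.
  by apply/le_anti; rewrite (le_trans h4 h5) (le_trans (le_trans h1 h2) h3).
split; first by split.
  by apply/le_anti; rewrite h2 lE h1.
by apply/le_anti; rewrite h4 uE h5.
Qed.

Section Optimality.
Variables (R : realType) (Q : network R) (alpha : {posnum R}).
Hypothesis h_girth : ((alpha%:num)%:E <= girth Q)%E.
Local Notation v :=
  (alpha%:num / (mu Q + #|[set v : node Q | leaf v]%SET|%:R * alpha%:num / 2)).

Let mu_gt0 : 0 < mu Q.
Proof. by apply: fine_gt0; rewrite lambdaT_gt0 lambdaT ltry. Qed.

(** The two visits give [2 * al / L] with [L] equal to [2 * mu Q] plus [alpha] times the number of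
    leaves, which is the claimed value. Only the value of [beta] is fixed, so any packaging of
    [alpha] as a nonnegative real fits. *)
Lemma tour_payoff_ge (beta : {nonneg R}) (w : seq (darc Q)) (tour_w : double_tour w)
    (A : probability (attack Q) R) : beta%:num = alpha%:num ->
  (v%:E <= payoff alpha (random_extension (tour_path beta tour_w)) A)%E.
Proof.
move=> betaE; have la0 : 0 <= #|[set v : node Q | leaf v]%SET|%:R * alpha%:num by rewrite mulr_ge0.
apply: le_payoff.
  by rewrite divr_ge0// addr_ge0 ?(ltW mu_gt0)// divr_ge0.
move=> [q tau].
have [s1 [s2 [h1 h2 h3 h4 [c1 c2]]]] := tour_visits h_girth betaE tour_w q.
apply: le_trans (random_extension_ge tau h1 h2 h3 h4 c1 c2).
rewrite [period _](follow_time_tour tour_w) betaE lee_fin le_eqVlt.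
apply/orP; left; apply/eqP; move: la0; move: (_%:R * _) => la la0.
by field; rewrite !gt_eqF//; have := mu_gt0; lra.
Qed.

Lemma independent_attack_payoff_le (P : probability (patrol Q) R) :
  (payoff alpha P (independent_attack alpha (leaf_nodes Q)) <= v%:E)%E.
Proof.
apply: payoff_le => S; apply: independent_attack_le; exact: le_leaf_arc.
Qed.

End Optimality.

Theorem theorem6 (R : realType) (Q : network R) (alpha : {posnum R})
    (h_cover : ((alpha%:num)%:E < min_cover Q)%E)
    (h_girth : ((alpha%:num)%:E <= girth Q)%E) :
  let l := #|[set v : node Q | leaf v]%SET| in
  [/\ is_value Q alpha (alpha%:num / (mu Q + l%:R * alpha%:num / 2))%:E,
      exists w : seq (darc Q), double_tour w,
      forall (w : seq (darc Q)) (tour_w : double_tour w),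
        patroller_optimal alpha
          (random_extension (tour_path (alpha%:num)%:nng tour_w)),
      independent alpha (leaf_nodes Q)
    & attacker_optimal alpha (independent_attack alpha (leaf_nodes Q))].
Proof.
move=> l.
have opt (beta : {nonneg R}) (betaE : beta%:num = alpha%:num) w
    (tour_w : double_tour w) := optimal_strategies
  (fun A => tour_payoff_ge h_girth tour_w A betaE)
  (independent_attack_payoff_le h_girth).
have [w0 tour0] := double_tour_exists Q.
have [val _ att] := opt (NngNum (ltW (gt0 alpha))) erefl w0 tour0.
split=> //; first by exists w0.
  move=> w tour_w.
  have H beta betaE := let: And3 _ p _ := opt beta betaE w tour_w in p.
  by apply: H.
exact: independent_leaf_nodes (le_leaf_arc h_girth).
Qed.
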